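(* Let $(\mathcal J,\mathcal J_1)$ be a dual pair of symmetrically normed ideals in $\mathcal B(\mathcal H)$ and let $a\in\mathcal B(\mathcal H)$ be normal. Then: (i) There exists a bounded linear operator $\widetilde E\colon\mathfrak u_{\mathcal J}\to\mathfrak u_{\mathcal J}$ with $\widetilde E^2=\widetilde E$ and $\widetilde E(\mathfrak u_{\mathcal J})=\mathrm L(\mathrm U_{\mathcal J}(a))$, and thus $$\mathfrak u_{\mathcal J}=\mathrm L(\mathrm U_{\mathcal J}(a))\oplus\operatorname{Ker}\widetilde E.$$ (ii) $\mathrm U_{\mathcal J}(a)$ is a Banach-Lie subgroup of $\mathrm U_{\mathcal J}$.
   Context: $\mathcal H$ is a separable infinite-dimensional complex Hilbert space, $\mathrm U(\mathcal H)$ its unitary group, $\mathbf 1$ the identity. A symmetrically normed ideal is a nonzero two-sided ideal $\mathcal J\subseteq\mathcal B(\mathcal H)$ with a norm $\|\cdot\|_{\mathcal J}$ making it a Banach space, with $\|axb\|_{\mathcal J}\le\|a\|\,\|x\|_{\mathcal J}\|b\|$ for $x\in\mathcal J$, $a,b\in\mathcal B(\mathcal H)$, normalized to be $1$ on rank-one projections. A pair $(\mathcal J,\mathcal J_1)$ of symmetrically normed ideals is a dual pair if $\mathcal J\mathcal J_1$ is contained in the trace class $\mathfrak S_1(\mathcal H)$ and the bilinear functional $\mathcal J\times\mathcal J_1\to\mathbb C$, $(x,y)\mapsto\operatorname{Tr}(xy)$, gives rise to an isometric isomorphism of $\mathcal J$ onto the topological dual $\mathcal J_1^*$. $\mathrm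 U_{\mathcal J}:=(\mathbf 1+\mathcal J)\cap\mathrm U(\mathcal H)$ is a (real) Banach-Lie group, with Lie algebra $\mathfrak u_{\mathcal J}=\{x\in\mathcal J\mid x^*=-x\}$. $\mathrm U_{\mathcal J}(a):=\{u\in\mathrm U_{\mathcal J}\mid uau^*=a\}$, and its Lie algebra is $\mathrm L(\mathrm U_{\mathcal J}(a))=\{x\in\mathfrak u_{\mathcal J}\mid xa=ax\}$. Banach-Lie subgroup means a subgroup which, with the inherited topology, is a Banach-Lie group and a submanifold, with Lie algebra a split closed subspace. *)

(* Defs.v *)
From HB Require Import structures.
From mathcomp Require Import all_boot all_order all_algebra.
From mathcomp Require Import sesquilinear complex.
From mathcomp Require Import all_classical all_reals all_analysis.

Set Implicit Arguments.
Unset Strict Implicit.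
Unset Printing Implicit Defensive.

Import Order.TTheory GRing.Theory Num.Theory.
Import numFieldNormedType.Exports.

Local Open Scope classical_set_scope.
Local Open Scope ring_scope.
Local Open Scope complex_scope.

(** An operator ideal carries its own norm, which is not the operator norm, and
    u_J is a real but not a complex subspace of it; hence real subspaces of a
    complex space, with a norm that is only meaningful on the carrier. *)

Record normedSubspace (R : realType) (V : lmodType R[i]) := NormedSubspace {
  ns_carrier :> V -> Prop ;
  ns_norm : V -> R ;
  ns_0 : ns_carrier 0 ;
  ns_D : forall x y, ns_carrier x -> ns_carrier y -> ns_carrier (x + y) ;
  ns_Z : forall (r : R) x, ns_carrier x -> ns_carrier (r%:C *: x) ;
  ns_normD : forall x y, ns_carrier x -> ns_carrier y ->
    ns_norm (x + y) <= ns_norm x + ns_norm y ;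
  ns_normZ : forall (r : R) x, ns_carrier x ->
    ns_norm (r%:C *: x) = `|r| * ns_norm x ;
  ns_norm_eq0 : forall x, ns_carrier x -> ns_norm x = 0 -> x = 0
}.

Record elt (R : realType) (V : lmodType R[i]) (S : normedSubspace V) := Elt {
  elt_val :> V ;
  eltP : ns_carrier S elt_val
}.

Section EltNormedModule.
Variables (R : realType) (V : lmodType R[i]) (S : normedSubspace V).

HB.instance Definition _ := gen_eqMixin (elt S).
HB.instance Definition _ := gen_choiceMixin (elt S).

Lemma elt_inj : injective (@elt_val R V S).
Proof.
by move=> [x Sx] [y Sy] /= xy; subst y; congr Elt; exact: Prop_irrelevance.
Qed.

Fact oppP (x : elt S) : ns_carrier S (- elt_val x).
Proof. by have := ns_Z (-1) (eltP x); rewrite rmorphN1 scaleN1r. Qed.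

Definition elt0 : elt S := Elt (ns_0 S).
Definition eltN (x : elt S) : elt S := Elt (oppP x).
Definition eltD (x y : elt S) : elt S := Elt (ns_D (eltP x) (eltP y)).
Definition eltZ (r : R) (x : elt S) : elt S := Elt (ns_Z r (eltP x)).

Fact eltDA : associative eltD.
Proof. by move=> x y z; apply: elt_inj; exact: addrA. Qed.
Fact eltDC : commutative eltD.
Proof. by move=> x y; apply: elt_inj; exact: addrC. Qed.
Fact elt0D : left_id elt0 eltD.
Proof. by move=> x; apply: elt_inj; exact: add0r. Qed.
Fact eltND : left_inverse elt0 eltN eltD.
Proof. by move=> x; apply: elt_inj; exact: addNr. Qed.

HB.instance Definition _ :=
  GRing.isZmodule.Build (elt S) eltDA eltDC elt0D eltND.

Fact eltZA (a b : R) (x : elt S) : eltZ a (eltZ b x) = eltZ (a * b) x.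
Proof. by apply: elt_inj; rewrite /= scalerA rmorphM. Qed.
Fact elt1Z : left_id 1 eltZ.
Proof. by move=> x; apply: elt_inj; rewrite /= rmorph1 scale1r. Qed.
Fact eltZDr : right_distributive eltZ +%R.
Proof. by move=> a x y; apply: elt_inj; exact: scalerDr. Qed.
Fact eltZDl (x : elt S) : {morph eltZ^~ x : a b / a + b}.
Proof. by move=> a b; apply: elt_inj; rewrite /= rmorphD scalerDl. Qed.

HB.instance Definition _ :=
  GRing.Zmodule_isLmodule.Build R (elt S) eltZA elt1Z eltZDr eltZDl.

Definition elt_norm (x : elt S) : R := ns_norm S (elt_val x).

Fact elt_normD x y : elt_norm (x + y) <= elt_norm x + elt_norm y.
Proof. exact: ns_normD (eltP x) (eltP y). Qed.
Fact elt_normZ (r : R) x : elt_norm (r *: x) = `|r| * elt_norm x.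
Proof. exact: ns_normZ r _ (eltP x). Qed.
Fact elt_norm_eq0 x : elt_norm x = 0 -> x = 0.
Proof. by move=> x0; apply: elt_inj; exact: ns_norm_eq0 (eltP x) x0. Qed.

HB.instance Definition _ :=
  Lmodule_isNormed.Build R (elt S) elt_normD elt_normZ elt_norm_eq0.

Definition banach : Prop :=
  forall F : set_system (elt S), ProperFilter F -> cauchy F -> cvg F.

End EltNormedModule.

Section Operators.
Variables (R : realType) (H : completeNormedModType R[i]).
Variable dot : {dot H for Num.conj}.
Implicit Types (a b x y u v p T P : H -> H) (J : normedSubspace (H -> H)).

Definition is_hilbert : Prop := forall h : H, `|h| ^+ 2 = dot h h.

Definition separable : Prop := exists2 A : set H, countable A & dense A.

Definition infinite_dim : Prop :=
  ~ exists n (e : 'I_n -> H), forall h, exists c : 'I_n -> R[i],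
      h = \sum_i c i *: e i.

(** The norm of [H] takes its values in the nonnegative reals inside [R[i]]. *)
Definition hnorm (h : H) : R := complex.Re `|h|.

Definition bounded_op : set (H -> H) :=
  [set a | linear a /\ exists M : R, forall h, hnorm (a h) <= M * hnorm h].

Definition opnorm a : R := sup [set hnorm (a h) | h in [set h | hnorm h <= 1]].

(** [b] is the (unique) adjoint of [a]. *)
Definition adjoint a b : Prop := forall h k, dot (a h) k = dot h (b k).

Definition normal_op a : Prop :=
  bounded_op a /\ exists2 a', adjoint a a' & a \o a' = a' \o a.

Definition unitary : set (H -> H) :=
  [set u | bounded_op u /\
           exists u', [/\ adjoint u u', u \o u' = id & u' \o u = id]].

Definition positive_op P : Prop := bounded_op P /\ forall h, 0 <= dot (P h) h.

(** [P] is the absolute value (T^* T)^(1/2). *)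
Definition abs_op T P : Prop :=
  positive_op P /\ exists2 T', adjoint T T' & P \o P = T' \o T.

Definition orthonormal_basis : set (nat -> H) :=
  [set e | (forall m n, dot (e m) (e n) = (m == n)%:R) /\
           (forall h, (forall n, dot h (e n) = 0) -> h = 0)].

(** An arbitrary but fixed orthonormal basis; trace-class membership and the
    trace do not depend on it. *)
Definition onb : nat -> H := xget (fun=> 0) orthonormal_basis.

Definition trace_class : set (H -> H) :=
  [set T | bounded_op T /\ exists2 P, abs_op T P &
     cvgn (series (fun n => complex.Re (dot (P (onb n)) (onb n))))].

Definition Tr T : R[i] :=
  limn (series (fun n => complex.Re (dot (T (onb n)) (onb n)))) +i*
  limn (series (fun n => complex.Im (dot (T (onb n)) (onb n)))).

Record symm_normed_ideal J : Prop := SymmNormedIdeal {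
  sni_bounded : forall x, J x -> bounded_op x ;
  sni_neq0 : exists2 x, J x & x <> 0 ;
  sni_scale : forall (c : R[i]) x, J x ->
    J (c *: x) /\ ns_norm J (c *: x) = Normc.normc c * ns_norm J x ;
  sni_ideal : forall a x b, bounded_op a -> J x -> bounded_op b ->
    J (a \o x \o b) /\
    ns_norm J (a \o x \o b) <= opnorm a * ns_norm J x * opnorm b ;
  sni_banach : banach J ;
  sni_rank1 : forall e : H, hnorm e = 1 ->
    J (fun h => dot h e *: e) /\ ns_norm J (fun h => dot h e *: e) = 1
}.

(** Elements of the topological dual of the complex Banach space [J],
    represented by functions whose values off [J] are irrelevant. *)
Definition bounded_functional J (phi : (H -> H) -> R[i]) : Prop :=
  (forall (c : R[i]) x y, J x -> J y -> phi (c *: x + y) = c * phi x + phi y) /\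
  (exists M : R, forall x, J x -> Normc.normc (phi x) <= M * ns_norm J x).

Definition functional_norm J (phi : (H -> H) -> R[i]) : R :=
  sup [set Normc.normc (phi x) | x in [set x | J x /\ ns_norm J x <= 1]].

Record dual_pair J J1 : Prop := DualPair {
  dp_ideal : symm_normed_ideal J ;
  dp_ideal1 : symm_normed_ideal J1 ;
  dp_trace_class : forall x y, J x -> J1 y -> trace_class (x \o y) ;
  dp_isometry : forall x, J x ->
    bounded_functional J1 (fun y => Tr (x \o y)) /\
    functional_norm J1 (fun y => Tr (x \o y)) = ns_norm J x ;
  dp_onto : forall phi, bounded_functional J1 phi ->
    exists2 x, J x & forall y, J1 y -> phi y = Tr (x \o y)
}.

Definition skew_adjoint x : Prop := adjoint x (- x).

Lemma skew_adjoint0 : skew_adjoint 0.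
Proof. by move=> h k; rewrite /= !fctE oppr0 linear0l linear0r. Qed.

Lemma skew_adjointD x y :
  skew_adjoint x -> skew_adjoint y -> skew_adjoint (x + y).
Proof.
move=> sx sy h k; have := sx h k; have := sy h k; rewrite !fctE /=.
by rewrite linearDl opprD linearDr /= => -> ->.
Qed.

Lemma skew_adjointZ (r : R) x : skew_adjoint x -> skew_adjoint (r%:C *: x).
Proof.
move=> sx h k; have := sx h k; rewrite !fctE /= => E.
rewrite linearZl_LR -scalerN linearZr_LR /= conj_Creal; last first.
  by rewrite complex_real.
by congr (_ * _).
Qed.

Definition uJ J : normedSubspace (H -> H) :=
  @NormedSubspace R (H -> H) [set x | J x /\ skew_adjoint x] (ns_norm J)
    (conj (ns_0 J) skew_adjoint0)
    (fun x y Jx Jy => conj (ns_D Jx.1 Jy.1) (skew_adjointD Jx.2 Jy.2))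
    (fun r x Jx => conj (ns_Z r Jx.1) (skew_adjointZ r Jx.2))
    (fun x y Jx Jy => ns_normD Jx.1 Jy.1)
    (fun r x Jx => ns_normZ r Jx.1)
    (fun x Jx => ns_norm_eq0 Jx.1).

Definition UJ J : set (H -> H) := [set u | J (u - id) /\ unitary u].

Definition UJ_stab J a : set (H -> H) :=
  [set u | UJ J u /\ exists2 u', adjoint u u' & u \o a \o u' = a].

Definition LUJ_stab J a : set (H -> H) := [set x | uJ J x /\ x \o a = a \o x].

End Operators.

Section Smooth.
Variable R : realType.

(** [k]-fold Frechet differentiability, through the iterated tangent maps
    (x, v) |-> 'd f x v; asking it for all [k] amounts to being C^oo. *)
Fixpoint diff_upto (k : nat) (E F : normedModType R) (U : set E) (f : E -> F)
    : Prop :=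
  if k is k'.+1 then
    (forall x, U x -> differentiable f x) /\
    @diff_upto k' (E * E)%type F (U `*` setT) (fun p => 'd f (p.1) (p.2))
  else forall x, U x -> {for x, continuous f}.

(** Smoothness on an arbitrary subset: local extendability to a smooth map
    defined on an open set. *)
Definition smooth_map (E F : normedModType R) (A : set E) (f : E -> F) : Prop :=
  forall p, A p -> exists (U : set E) (g : E -> F),
    [/\ open U, U p, forall k, diff_upto k U g &
        forall x, A x -> U x -> f x = g x].

Variable E : normedModType R.
Implicit Types (M N L K g U O : set E) (phi psi : E -> E).

Definition closed_subspace L : Prop :=
  [/\ closed L, L 0 & forall (r : R) x y, L x -> L y -> L (r *: x + y)].

Definition split_subspace g L : Prop :=
  [/\ closed_subspace L, L `<=` g & exists K,
    [/\ closed_subspace K, K `<=` g, L `&` K `<=` [set 0] &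
        forall x, g x -> exists y z, [/\ L y, K z & x = y + z]]].

(** [phi] is a diffeomorphism, with inverse [psi], of the relatively open part
    [M `&` U] of [M] onto the open part [g `&` O] of the model space [g]. *)
Definition chart M g U O phi psi : Prop :=
  [/\ open U /\ open O,
      smooth_map (M `&` U) phi, smooth_map (g `&` O) psi,
      forall x, (M `&` U) x -> (g `&` O) (phi x) /\ psi (phi x) = x &
      forall y, (g `&` O) y -> (M `&` U) (psi y) /\ phi (psi y) = y].

Definition manifold M g : Prop :=
  closed_subspace g /\
  forall p, M p -> exists U O phi psi, U p /\ chart M g U O phi psi.

Definition submanifold M g N L : Prop :=
  N `<=` M /\
  forall p, N p -> exists U O phi psi,
    [/\ U p, chart M g U O phi psi &
        forall x, (M `&` U) x -> (N x <-> L (phi x))].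

Definition tangent_space M (p : E) : set E :=
  [set v | exists c : R -> E,
     [/\ smooth_map [set: R^o] c, forall t, M (c t), c 0 = p & derive1 c 0 = v]].

End Smooth.

(** The set id + J is identified with the real Banach space [elt J] through
    u |-> u - id, and subgroups of it carry the topology and the smooth
    structure inherited from this space. *)

Section LieGroups.
Variables (R : realType) (H : completeNormedModType R[i]).
Variable J : normedSubspace (H -> H).
Implicit Types (G N g h : set (H -> H)).

Definition in_chart G : set (elt J) := [set x | G (id + elt_val x)].

Definition in_ideal g : set (elt J) := [set x | g (elt_val x)].

Definition op_group G : Prop :=
  [/\ G id, forall u v, G u -> G v -> G (u \o v) &
      forall u, G u -> exists2 v, G v & u \o v = id /\ v \o u = id].

Definition banach_lie_group G g : Prop :=
  [/\ op_group G /\ (forall u, G u -> J (u - id)),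
      manifold (in_chart G) (in_ideal g),
      exists2 mu : elt J * elt J -> elt J,
        smooth_map (in_chart G `*` in_chart G) mu &
        forall x y, in_chart G x -> in_chart G y ->
          id + elt_val (mu (x, y)) = (id + elt_val x) \o (id + elt_val y),
      exists2 nu : elt J -> elt J,
        smooth_map (in_chart G) nu &
        forall x, in_chart G x ->
          (id + elt_val x) \o (id + elt_val (nu x)) = id &
      tangent_space (in_chart G) 0 = in_ideal g].

(** [N], with Lie algebra [h], is a Banach-Lie subgroup of the Banach-Lie group
    [G], whose Lie algebra is [g]. *)
Definition banach_lie_subgroup G g N h : Prop :=
  [/\ banach_lie_group N h,
      split_subspace (in_ideal g) (in_ideal h) &
      submanifold (in_chart G) (in_ideal g) (in_chart N) (in_ideal h)].

End LieGroups.

(* Main.v *)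
Require Import Defs.
From HB Require Import structures.
From mathcomp Require Import all_boot all_order all_algebra.
From mathcomp Require Import sesquilinear complex.
From mathcomp Require Import all_classical all_reals all_analysis.
From mathcomp Require Import ring lra.

Set Implicit Arguments.
Unset Strict Implicit.
Unset Printing Implicit Defensive.

Import Order.TTheory GRing.Theory Num.Theory.
Import numFieldNormedType.Exports.

Local Open Scope classical_set_scope.
Local Open Scope ring_scope.
Local Open Scope complex_scope.

(** The elements of u_J that commute with a are the range of an averaging
    projection, and the Cayley transform turns the unitary group near a point
    into the linear space u_J in a way that respects commutation with a.

    For (i), let u be unitary.  The conjugates u^n x u^-n of an element x of J
    stay in a ball of J, and J is the dual of J1, so they have a mean: for a
    Banach limit LIM the functional y |-> LIM Tr (u^n x u^-n y) on J1 is bounded,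
    hence equal to Tr (E x y) for some E x in J ([orbit_mean_exists]).  Taking
    for y the operators of rank one shows that
    << E x h, k >> = LIM << u^n x u^-n h, k >>, and linearity of E, commutation
    of E x with u and preservation of skewness can all be read off from these
    matrix coefficients ([mean_projection_exists]).  The real and imaginary
    parts of a, multiplied by i and by a small constant, are skew; their Cayley
    transforms u and v are commuting unitaries, and an operator commutes with
    a and its adjoint exactly when it commutes with u and v.  The composite of
    the two averages is the required projection ([commutant_projection]).  A
    skew x that commutes with a also commutes with the adjoint of a, so it is
    fixed.

    For (ii), U_J lies in 1 + J, and J is a Banach algebra without unit.  The map
    z |-> (1 + z)^-1 - 1 is defined on an open set, and it is smooth because its
    derivative is a polynomial in its own value ([smooth_bootstrap],
    [smooth_qinv]).  The chart of U_J around p is the Cayley transform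
    u |-> (p^-1 u - 1) (p^-1 u + 1)^-1, whose inverse is
    x |-> p (1 + x) (1 - x)^-1; the latter is defined on all of u_J since 1 - x is
    invertible in 1 + J for every skew x ([skew_regular]).  When p commutes with
    a, this chart sends the elements of U_J that commute with a onto those of
    u_J that do ([stab_submanifold]), so the stabilizer is a submanifold, and (i)
    gives the closed complement of its Lie algebra ([stab_split]). *)

(** * Calculus of smooth maps between normed spaces *)

Section SmoothCalculus.
Variable R : realType.
Implicit Types E F G : normedModType R.

Lemma is_diff_small E F (f : E -> F) (L : {linear E -> F}) x :
  continuous L ->
  (forall e, 0 < e -> \forall h \near (0 : E), `|f (h + x) - f x - L h| <= e * `|h|) ->
  is_diff x f L.
Proof.
move=> cL fL.
have fLo : f \o shift x = cst (f x) + L +o_ (0 : E) id.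
  apply/eqaddoP => e e0; near=> h => /=.
  rewrite !fctE /= opprD addrA; near: h; exact: fL.
have dfL := diff_unique cL fLo.
by apply: DiffDef => //; apply/diff_locallyP; rewrite dfL.
Unshelve. all: by end_near. Qed.

Lemma differentiable_small E F (f : E -> F) x : differentiable f x ->
  forall e, 0 < e -> \forall h \near (0 : E), `|f (h + x) - f x - 'd f x h| <= e * `|h|.
Proof.
move=> /diff_locallyP[_ /eqaddoP df] e e0; near=> h.
rewrite -addrA -opprD; near: h; exact: df.
Unshelve. all: by end_near. Qed.

Lemma is_diff_near E F (f g : E -> F) x : (\forall y \near x, f y = g y) ->
  differentiable f x -> is_diff x g ('d f x).
Proof.
move=> fg df; apply: is_diff_small; first exact: diff_continuous.
move=> e e0; near=> h.
rewrite -(nbhs_singleton fg).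
have <- : f (h + x) = g (h + x).
  by rewrite addrC; near: h; move/nbhs0P: fg; apply.
near: h; exact: differentiable_small.
Unshelve. all: by end_near. Qed.

Lemma open_setXT E F (U : set E) : open U -> open (U `*` @setT F).
Proof.
move=> oU; have -> : U `*` @setT F = fst @^-1` U.
  by apply/seteqP; split=> -[x y] //= [].
by apply: open_comp => // x _; exact: cvg_fst.
Qed.

Lemma fst_continuous E F : continuous (fst : E * F -> E).
Proof. by move=> x; exact: cvg_fst. Qed.

Lemma snd_continuous E F : continuous (snd : E * F -> F).
Proof. by move=> x; exact: cvg_snd. Qed.

Definition smooth_on E F (U : set E) (f : E -> F) := forall k, diff_upto k U f.

Lemma near_open E (U : set E) x : open U -> U x -> \forall y \near x, U y.
Proof. by move=> oU Ux; apply: open_nbhs_nbhs. Qed.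

Lemma diff_upto_ext k : forall E F (U : set E) (f g : E -> F), open U ->
  (forall x, U x -> f x = g x) -> diff_upto k U f -> diff_upto k U g.
Proof.
elim: k => [|k IH] E F U f g oU fg /=.
  move=> cf x Ux; rewrite /prop_for /continuous_at -(fg x Ux).
  apply: cvg_trans (cf x Ux); apply: near_eq_cvg.
  by near=> y; rewrite fg //; near: y; exact: near_open.
have dg x : U x -> differentiable f x -> is_diff x g ('d f x).
  move=> Ux; apply: is_diff_near; near=> y.
  by apply: fg; near: y; exact: near_open.
move=> [df d2f]; split=> [x Ux|]; first by have [] := dg x Ux (df x Ux).
apply: IH d2f; first exact: open_setXT.
by move=> [x v] [/= Ux _]; have [_ ->] := dg x Ux (df x Ux).
Unshelve. all: by end_near. Qed.

Lemma diff_upto_sub k : forall E F (U V : set E) (f : E -> F), V `<=` U ->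
  diff_upto k U f -> diff_upto k V f.
Proof.
elim: k => [|k IH] E F U V f VU /=; first by move=> cf x /VU; exact: cf.
move=> [df d2f]; split=> [x /VU|]; first exact: df.
by apply: IH d2f => -[x v] [/VU].
Qed.

Lemma diff_upto_pred k : forall E F (U : set E) (f : E -> F),
  diff_upto k.+1 U f -> diff_upto k U f.
Proof.
elim: k => [|k IH] E F U f [df d2f]; first by move=> x /df; exact: differentiable_continuous.
by split=> //; apply: IH.
Qed.

Lemma diff_upto_linear k : forall E F (U : set E) (f : {linear E -> F}),
  continuous f -> diff_upto k U f.
Proof.
elim: k => [|k IH] E F U f cf /=; first by move=> x _; exact: cf.
split=> [x _|]; first exact: linear_differentiable.
have lin : linear (f \o snd : E * E -> F) by move=> r x y /=; rewrite linearP.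
pose g : {linear (E * E)%type -> F} := HB.pack (f \o snd : E * E -> F) (GRing.isLinear.Build _ _ _ _ _ lin).
have -> : (fun p : E * E => 'd f (p.1) (p.2)) = g.
  by apply/funext => -[x v] /=; rewrite diff_lin.
by apply: IH => x; apply: continuous_comp; [exact: cvg_snd|exact: cf].
Qed.

Lemma diff_upto_fst k E F (U : set (E * F)) : diff_upto k U fst.
Proof.
have h := @diff_upto_linear k _ _ U (fst : {linear (E * F)%type -> E})
  (@fst_continuous E F).
exact: h.
Qed.

Lemma diff_upto_snd k E F (U : set (E * F)) : diff_upto k U snd.
Proof.
have h := @diff_upto_linear k _ _ U (snd : {linear (E * F)%type -> F})
  (@snd_continuous E F).
exact: h.
Qed.

Lemma diff_upto_cst k : forall E F (U : set E) (c : F), diff_upto k U (cst c : E -> F).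
Proof.
elim: k => [|k IH] E F U c /=; first by move=> x _; exact: cvg_cst.
split=> [x _|]; first exact: differentiable_cst.
have -> : (fun p : E * E => 'd (cst c : E -> F) (p.1) (p.2)) = cst 0.
  by apply/funext => -[x v] /=; rewrite diff_cst.
exact: IH.
Qed.

Lemma diff_upto_pair k : forall E F G (U : set E) (f : E -> F) (g : E -> G), open U ->
  diff_upto k U f -> diff_upto k U g -> diff_upto k U (fun x => (f x, g x)).
Proof.
elim: k => [|k IH] E F G U f g oU /=.
  by move=> cf cg x Ux; apply: cvg_pair; [exact: cf|exact: cg].
move=> [df d2f] [dg d2g]; split=> [x Ux|].
  by apply: differentiable_pair; [exact: df|exact: dg].
apply: (@diff_upto_ext _ _ _ _ (fun p : E * E => ('d f (p.1) (p.2), 'd g (p.1) (p.2)))).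
- exact: open_setXT.
- by move=> [x v] [/= Ux _]; rewrite diff_pair //; [exact: df|exact: dg].
- by apply: IH => //; exact: open_setXT.
Qed.

(** The tangent map of [g \o f] is the composite of the tangent map of [g] with
    (x, v) |-> (f x, 'd f x v), so the induction stays among composites. *)
Lemma diff_upto_comp k : forall E F G (U : set E) (V : set F) (f : E -> F) (g : F -> G),
  open U -> (forall x, U x -> V (f x)) ->
  diff_upto k U f -> diff_upto k V g -> diff_upto k U (g \o f).
Proof.
elim: k => [|k IH] E F G U V f g oU UV /=.
  by move=> cf cg x Ux; apply: continuous_comp; [exact: cf|exact/cg/UV].
move=> [df d2f] [dg d2g]; split=> [x Ux|].
  by apply: differentiable_comp; [exact: df|exact/dg/UV].
apply: (@diff_upto_ext _ _ _ _
   ((fun p : F * F => 'd g (p.1) (p.2)) \o (fun p : E * E => (f p.1, 'd f (p.1) (p.2))))).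
- exact: open_setXT.
- by move=> [x v] [/= Ux _]; rewrite (diff_comp (df x Ux) (dg _ (UV x Ux))).

have oU2 := @open_setXT E E _ oU.
apply: (IH _ _ _ _ _ _ _ _ _ _ d2g) => //; first by move=> [x v] [/= /UV Vfx _].
apply: diff_upto_pair => //.
apply: (IH _ _ _ _ U fst f) => //; first by move=> [x v] [].
  exact: diff_upto_fst.
exact: (@diff_upto_pred k _ _ U f).
Qed.

Lemma diff_uptoD k E F (U : set E) (f g : E -> F) : open U ->
  diff_upto k U f -> diff_upto k U g -> diff_upto k U (fun x => f x + g x).
Proof.
move=> oU sf sg.
have lin : linear (fun p : F * F => p.1 + p.2).
  by move=> r x y /=; rewrite scalerDr addrACA.
pose add2 : {linear (F * F)%type -> F} :=
  HB.pack (fun p : F * F => p.1 + p.2) (GRing.isLinear.Build _ _ _ _ _ lin).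
have cadd : continuous add2 by exact: add_continuous.
exact: (diff_upto_comp oU (fun _ _ => I) (diff_upto_pair oU sf sg)
  (@diff_upto_linear k _ _ setT add2 cadd)).
Qed.

Lemma smooth_linear E F (U : set E) (f : {linear E -> F}) : continuous f -> smooth_on U f.
Proof. by move=> cf k; exact: diff_upto_linear. Qed.

Lemma smooth_pair E F G (U : set E) (f : E -> F) (g : E -> G) : open U ->
  smooth_on U f -> smooth_on U g -> smooth_on U (fun x => (f x, g x)).
Proof. by move=> oU sf sg k; exact: diff_upto_pair. Qed.

Lemma smooth_comp E F G (U : set E) (V : set F) (f : E -> F) (g : F -> G) : open U ->
  (forall x, U x -> V (f x)) -> smooth_on U f -> smooth_on V g -> smooth_on U (g \o f).
Proof. by move=> oU UV sf sg k; exact: (@diff_upto_comp k _ _ _ _ V). Qed.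

Lemma smooth_fst E F (U : set (E * F)) : smooth_on U fst.
Proof. by move=> k; exact: diff_upto_fst. Qed.

Lemma smooth_snd E F (U : set (E * F)) : smooth_on U snd.
Proof. by move=> k; exact: diff_upto_snd. Qed.

Lemma smooth_id E (U : set E) : smooth_on U id.
Proof. exact: (@smooth_linear _ _ _ (idfun : {linear E -> E}) (fun=> cvg_id)). Qed.

Lemma smooth_cst E F (U : set E) (c : F) : smooth_on U (cst c).
Proof. by move=> k; exact: diff_upto_cst. Qed.

Lemma smoothD E F (U : set E) (f g : E -> F) : open U ->
  smooth_on U f -> smooth_on U g -> smooth_on U (fun x => f x + g x).
Proof. by move=> oU sf sg k; exact: diff_uptoD. Qed.

Lemma smoothZ E F (U : set E) (r : R) (f : E -> F) : open U ->
  smooth_on U f -> smooth_on U (fun x => r *: f x).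
Proof.
move=> oU sf; apply: (smooth_comp (V := setT) oU _ sf) => //.
exact: (@smooth_linear _ _ _ ( *:%R r : {linear F -> F}) (fun x => @scaler_continuous _ _ r x)).
Qed.

Lemma smoothN E F (U : set E) (f : E -> F) : open U ->
  smooth_on U f -> smooth_on U (fun x => - f x).
Proof.
move=> oU /(smoothZ (-1) oU).
by under [X in smooth_on _ X]eq_fun do rewrite scaleN1r.
Qed.

Lemma smooth_sub E F (U V : set E) (f : E -> F) : V `<=` U ->
  smooth_on U f -> smooth_on V f.
Proof. by move=> VU sf k; apply: diff_upto_sub (sf k). Qed.

Lemma smooth_differentiable E F (U : set E) (f : E -> F) x :
  smooth_on U f -> U x -> differentiable f x.
Proof. by move=> /(_ 1%N)[df _] /df. Qed.

Lemma open_smooth_preimage E F (f : E -> F) (V : set F) :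
  smooth_on setT f -> open V -> open (f @^-1` V).
Proof.
move=> sf; apply: open_comp => x _.
by apply: differentiable_continuous; exact: smooth_differentiable sf _.
Qed.

Lemma smooth_comp_preimage E F G (f : E -> F) (g : F -> G) (V : set F) :
  smooth_on setT f -> open V -> smooth_on V g ->
  smooth_on (f @^-1` V) (fun x => g (f x)).
Proof.
move=> sf oV sg; apply: (@smooth_comp _ _ _ _ V f g _ _ _ sg) => //.
  exact: open_smooth_preimage.
exact: smooth_sub sf.
Qed.

Lemma bounded_continuous E F (f : {linear E -> F}) (C : R) :
  (forall x, `|f x| <= C * `|x|) -> continuous f.
Proof.
move=> fC; apply/linear_bounded_continuous/linear_boundedP.
near=> r => x; apply: le_trans (fC x) _.
by apply: ler_wpM2r.
Unshelve. all: by end_near. Qed.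

Section Bilinear.
Variables (E F G : normedModType R) (b : E -> F -> G) (C : R).
Hypothesis bDl : forall x x' y, b (x + x') y = b x y + b x' y.
Hypothesis bDr : forall x y y', b x (y + y') = b x y + b x y'.
Hypothesis bZl : forall (r : R) x y, b (r *: x) y = r *: b x y.
Hypothesis bZr : forall (r : R) x y, b x (r *: y) = r *: b x y.
Hypothesis bC : forall x y, `|b x y| <= C * `|x| * `|y|.

Lemma is_diff_bounded_bilinear (p : E * F) :
  is_diff p (fun q => b q.1 q.2) (fun q => b p.1 q.2 + b q.1 p.2).
Proof.
pose d (q : E * F) := b p.1 q.2 + b q.1 p.2.
have lin : linear d.
  by move=> r x y; rewrite /d /= bDr bDl bZr bZl scalerDr addrACA.
pose L : {linear (E * F)%type -> G} := HB.pack d (GRing.isLinear.Build _ _ _ _ _ lin).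
pose C' := `|C| + 1.
have C'gt0 : 0 < C' by rewrite ltr_wpDl.
have C'0 := ltW C'gt0.
have bC' x y : `|b x y| <= C' * `|x| * `|y|.
  apply: le_trans (bC x y) _; rewrite !ler_wpM2r//.
  by apply: le_trans (ler_norm C) _; rewrite lerDl.
have n1 (q : E * F) : `|q.1| <= `|q| by rewrite prod_normE le_max lexx.
have n2 (q : E * F) : `|q.2| <= `|q| by rewrite prod_normE le_max lexx orbT.
rewrite -/d -[d]/(L : _ -> _); apply: is_diff_small.
  apply: (@bounded_continuous _ _ _ (C' * `|p.1| + C' * `|p.2|)) => q.
  apply: le_trans (ler_normD _ _) _; rewrite mulrDl lerD//.
    by apply: le_trans (bC' _ _) _; rewrite ler_wpM2l// mulr_ge0.
  by apply: le_trans (bC' _ _) _; rewrite mulrAC ler_wpM2l// mulr_ge0.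
move=> e e0; near=> h.
have -> : b (h + p).1 (h + p).2 - b p.1 p.2 - L h = b h.1 h.2.
  have zlem (x y z t : G) : x + y + (z + t) - t - (z + y) = x.
    by rewrite addrA addrK -[x + y + z]addrA [y + z]addrC addrK.
  by rewrite /= /d bDl !bDr zlem.
apply: le_trans (bC' _ _) _; apply: ler_pM => //; first exact: mulr_ge0.
rewrite mulrC -ler_pdivlMr//; apply: le_trans (n1 _) _.
near: h; have h := @nbhs0_le _ (E * F)%type (e / C').
by apply: h; rewrite divr_gt0.
Unshelve. all: by end_near. Qed.

(** The differential of [b] is a sum of two composites of [b] with coordinate
    maps, which is what closes the induction. *)
Lemma smooth_bilinear (D : normedModType R) (U : set D) (f : D -> E) (g : D -> F) :
  open U -> smooth_on U f -> smooth_on U g -> smooth_on U (fun x => b (f x) (g x)).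
Proof.
move=> oU sf sg.
suff sb : smooth_on setT (fun q : E * F => b q.1 q.2).
  exact: (smooth_comp oU (fun _ _ => I) (smooth_pair oU sf sg) sb).
elim=> [|k IH] /=.
  by move=> p _; apply/differentiable_continuous; have [] := is_diff_bounded_bilinear p.
split=> [p _|]; first by have [] := is_diff_bounded_bilinear p.
apply: (@diff_upto_ext _ _ _ _ (fun q : (E * F) * (E * F) => b q.1.1 q.2.2 + b q.2.1 q.1.2)).
- by rewrite setXTT; exact: openT.
- by move=> [p v] _ /=; have [_ ->] := is_diff_bounded_bilinear p.
- rewrite setXTT; apply: diff_uptoD; first exact: openT.
    apply: (@diff_upto_comp _ _ _ _ _ setT (fun q : (E * F) * (E * F) => (q.1.1, q.2.2))
      (fun q : E * F => b q.1 q.2) openT) => //.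
    apply: diff_upto_pair; first exact: openT.
      by apply: (@diff_upto_comp _ _ _ _ _ setT fst fst openT) => //; exact: smooth_fst.
    by apply: (@diff_upto_comp _ _ _ _ _ setT snd snd openT) => //; exact: smooth_snd.
  apply: (@diff_upto_comp _ _ _ _ _ setT (fun q : (E * F) * (E * F) => (q.2.1, q.1.2))
    (fun q : E * F => b q.1 q.2) openT) => //.
  apply: diff_upto_pair; first exact: openT.
    by apply: (@diff_upto_comp _ _ _ _ _ setT snd fst openT) => //; [exact: smooth_snd|exact: smooth_fst].
  by apply: (@diff_upto_comp _ _ _ _ _ setT fst snd openT) => //; [exact: smooth_fst|exact: smooth_snd].
Qed.
End Bilinear.

(** If [q] is C^k, so is its tangent map D (q x, v), hence [q] is C^(k+1).  This
    yields all derivatives of quasi-inversion from the first one. *)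
Lemma smooth_bootstrap E F (U : set E) (q : E -> F) (D : F * E -> F) : open U ->
  smooth_on setT D ->
  (forall x, U x -> differentiable q x /\ forall v, 'd q x v = D (q x, v)) ->
  smooth_on U q.
Proof.
move=> oU sD dq; elim=> [|k IH] /=.
  by move=> x /dq[/differentiable_continuous].
split=> [x /dq[]//|].
apply: (@diff_upto_ext _ _ _ _ (D \o (fun p : E * E => (q p.1, p.2)))).
- exact: open_setXT.
- by move=> [x v] [/= /dq[_ ->]].
- apply: (@diff_upto_comp _ _ _ _ _ setT) => //; first exact: open_setXT.
  apply: diff_upto_pair; first exact: open_setXT.
    apply: (@diff_upto_comp _ _ _ _ _ U fst q); first exact: open_setXT.
    - by move=> [x v] [].
    - exact: smooth_fst.
    - exact: IH.
  exact: smooth_snd.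
Qed.

Lemma smooth_map_on E F (A U : set E) (f : E -> F) : open U -> A `<=` U ->
  smooth_on U f -> smooth_map A f.
Proof. by move=> oU AU sf p /AU Up; exists U, f. Qed.

End SmoothCalculus.

(** * Quasi-inversion in a Banach algebra without unit *)

(** Banach's fixed point theorem, applied to the contraction x |-> b + T x. *)
Lemma affine_fixed_point (R : realType) (E : normedModType R) (b : E) (T : {linear E -> E}) (c : R) :
  (forall F : set_system E, ProperFilter F -> cauchy F -> cvg F) ->
  c < 1 -> (forall x, `|T x| <= c * `|x|) -> exists x, x = b + T x.
Proof.
move=> EC c1 Tc.
pose E' : completeNormedModType R :=
  HB.pack (NormedModule.sort E) (Uniform_isComplete.Build (NormedModule.sort E) EC).
pose f (x : E') : E' := b + T x.
pose fT : {fun [set: E'] >-> [set: E']} := HB.pack f (isFun.Build _ _ setT setT f (fun _ _ => I)).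
have c'0 : 0 <= Num.max c 0 by rewrite le_max lexx orbT.
have [||x _ xE] := @banach_fixed_point R E' setT fT _ closedT; last by exists x.
  exists (NngNum c'0); split=> /=; first by rewrite gt_max c1 ltr01.
  move=> -[x y] _ /=; rewrite /f opprD addrACA subrr add0r -linearB.
  by apply: le_trans (Tc _) _; rewrite ler_wpM2r// le_max lexx.
by exists 0.
Qed.

Section QuasiInverse.
Variables (R : realType) (E : normedModType R) (m : E -> E -> E).
Hypothesis mDl : forall x x' y, m (x + x') y = m x y + m x' y.
Hypothesis mDr : forall x y y', m x (y + y') = m x y + m x y'.
Hypothesis mZl : forall (r : R) x y, m (r *: x) y = r *: m x y.
Hypothesis mZr : forall (r : R) x y, m x (r *: y) = r *: m x y.
Hypothesis mA : forall x y z, m x (m y z) = m (m x y) z.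
Hypothesis mle : forall x y, `|m x y| <= `|x| * `|y|.
Hypothesis EC : forall F : set_system E, ProperFilter F -> cauchy F -> cvg F.

(** 1 + circ x y = (1 + x) (1 + y): the multiplication of 1 + E, carried over to
    [E], which has no unit. *)
Definition circ x y := x + y + m x y.

Definition qinv_pair z w := circ z w = 0 /\ circ w z = 0.
Definition qregular : set E := [set z | exists w, qinv_pair z w].
(** 1 + qinv z is the inverse of 1 + z, if there is one; the value is 0
    otherwise. *)
Definition qinv z := xget 0 (qinv_pair z).

Let m0l y : m 0 y = 0.
Proof. by apply: (addrI (m 0 y)); rewrite -mDl !addr0. Qed.
Let m0r x : m x 0 = 0.
Proof. by apply: (addrI (m x 0)); rewrite -mDr !addr0. Qed.
Let mNl x y : m (- x) y = - m x y.
Proof. by apply/eqP; rewrite -addr_eq0 -mDl addNr m0l. Qed.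

Lemma circA : associative circ.
Proof.
move=> x y z; rewrite /circ !mDl !mDr !addrA mA.
by rewrite [LHS](ACl (1*2*5*3*6*4*7)).
Qed.

Lemma circ0l x : circ 0 x = x. Proof. by rewrite /circ m0l add0r addr0. Qed.
Lemma circ0r x : circ x 0 = x. Proof. by rewrite /circ m0r !addr0. Qed.

Lemma circDr x y h : circ x (y + h) = circ x y + (h + m x h).
Proof. by rewrite /circ mDr !addrA [LHS](ACl (1*2*4*3*5)). Qed.

Lemma circDl x y h : circ (y + h) x = circ y x + (h + m h x).
Proof. by rewrite /circ mDl !addrA [LHS](ACl (1*3*4*2*5)). Qed.

Lemma qinv_unique z w w' : circ w z = 0 -> circ z w' = 0 -> w = w'.
Proof. by move=> wz zw'; rewrite -(circ0r w) -zw' circA wz circ0l. Qed.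

Lemma qinvP z : qregular z -> qinv_pair z (qinv z).
Proof. by move=> [w zw]; apply: (xgetPex 0); exists w. Qed.

Lemma qinv_eq z w : qinv_pair z w -> qinv z = w.
Proof.
move=> zw; have /qinvP[_ h] : qregular z by exists w.
by case: zw => zw _; exact: qinv_unique h zw.
Qed.

Lemma qregular_qinv z : qregular z -> qregular (qinv z).
Proof. by move=> /qinvP[h1 h2]; exists z. Qed.

Lemma qinvK z : qregular z -> qinv (qinv z) = z.
Proof. by move=> /qinvP[h1 h2]; apply: qinv_eq. Qed.

Lemma qregular_circ z k : qregular z -> qregular k -> qregular (circ z k).
Proof.
move=> /qinvP[z1 z2] /qinvP[k1 k2]; exists (circ (qinv k) (qinv z)); split.
  by rewrite circA -(circA z) k1 circ0r.
by rewrite circA -(circA (qinv k)) z2 circ0r.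
Qed.

(** Neumann's series, in the form of fixed points of w |-> - z - z w and of
    w |-> - z - w z; the right and the left inverse that they give coincide. *)
Lemma qregular_small z : `|z| < 1 -> qregular z.
Proof.
move=> z1.
have linl : linear (fun w => - m z w) by move=> r x y; rewrite mDr mZr opprD scalerN.
have linr : linear (fun w => - m w z) by move=> r x y; rewrite mDl mZl opprD scalerN.
pose Tl : {linear E -> E} := HB.pack (fun w => - m z w) (GRing.isLinear.Build _ _ _ _ _ linl).
pose Tr : {linear E -> E} := HB.pack (fun w => - m w z) (GRing.isLinear.Build _ _ _ _ _ linr).
have [|w wE] := @affine_fixed_point R E (- z) Tl `|z| EC z1.
  by move=> x; rewrite normrN.
have [|w' w'E] := @affine_fixed_point R E (- z) Tr `|z| EC z1.
  by move=> x; rewrite normrN mulrC.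
have zw : circ z w = 0.
  have h : w + m z w = - z by rewrite {1}wE /= subrK.
  by rewrite /circ -addrA h subrr.
have wz : circ w' z = 0.
  have h : w' + m w' z = - z by rewrite {1}w'E /= subrK.
  by rewrite /circ addrAC h addNr.
by exists w; split=> //; rewrite -(qinv_unique wz zw).
Qed.

(** 1 + z + h = (1 + z) (1 + (1 + z)^-1 h). *)
Lemma qregular_shift z h : qregular z -> `|h| * (1 + `|qinv z|) < 1 -> qregular (h + z).
Proof.
move=> Wz hs; have [zq qz] := qinvP Wz.
have -> : h + z = circ z (h + m (qinv z) h).
  rewrite /circ mDr mA [RHS](_ : _ = z + h + m (circ z (qinv z)) h); last first.
    by rewrite /circ !mDl !addrA [LHS](ACl (1*2*4*3*5)).
  by rewrite zq m0l addr0 addrC.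
apply: qregular_circ => //; apply: qregular_small.
apply: le_lt_trans hs; apply: le_trans (ler_normD _ _) _.
by rewrite mulrDr mulr1 lerD2l mulrC.
Qed.

Lemma open_qregular : open qregular.
Proof.
rewrite openE => z Wz; apply/nbhs0P; near=> h.
rewrite addrC; apply: qregular_shift => //.
rewrite -ltr_pdivlMr; last by rewrite ltr_pwDl.
by near: h; apply: nbhs0_lt; rewrite divr_gt0// ltr_pwDl.
Unshelve. all: by end_near. Qed.

(** The resolvent identity
    (1 + z')^-1 - (1 + z)^-1 = - (1 + z')^-1 (z' - z) (1 + z)^-1. *)
Lemma qinv_sub z z' : qregular z -> qregular z' ->
  let k := (z' - z) + m (qinv z') (z' - z) in
  qinv z' - qinv z = - (k + m k (qinv z)).
Proof.
move=> Wz Wz' k; have [zq qz] := qinvP Wz; have [zq' qz'] := qinvP Wz'.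
have : qinv z = circ (circ (qinv z') (z + (z' - z))) (qinv z).
  by rewrite [z + _]addrC subrK qz' circ0l.
rewrite circDr circDl -circA zq circ0r => {1}->.
by rewrite opprD addrA subrr add0r.
Qed.

(** - (1 + q) v (1 + q) at p = (q, v): the derivative of inversion, written as a
    function of the value q of the quasi-inverse. *)
Definition qinv_diff (p : E * E) := - (p.2 + m p.1 p.2 + m (p.2 + m p.1 p.2) p.1).

(** Replacing (1 + z')^-1 by (1 + z)^-1 in the right-hand side of the resolvent
    identity changes it by a term that is quadratic in z' - z. *)
Lemma is_diff_qinv z : qregular z ->
  differentiable qinv z /\ forall v, 'd qinv z v = qinv_diff (qinv z, v).
Proof.
move=> Wz; pose q := qinv z; pose d v := qinv_diff (q, v).
have lin : linear d.
  move=> r x y; rewrite /d /qinv_diff /= !(mDr, mDl, mZr, mZl) scalerN -opprD; congr (- _).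
  by rewrite !scalerDr !addrA [LHS](ACl (1*3*5*7*2*4*6*8)).
pose L : {linear E -> E} := HB.pack d (GRing.isLinear.Build _ _ _ _ _ lin).
pose C := 1 + `|q|.
have C0 : 0 < C by rewrite ltr_pwDl.
have aux k : `|k + m k q| <= `|k| * C.
  by apply: le_trans (ler_normD _ _) _; rewrite mulrDr mulr1 lerD2l.
have aux' k : `|k + m q k| <= `|k| * C.
  by apply: le_trans (ler_normD _ _) _; rewrite mulrDr mulr1 lerD2l mulrC.
suff : is_diff z qinv L by move=> [? ->]; split.
apply: is_diff_small.
  apply: (@bounded_continuous _ _ _ _ (C * C)) => v /=.
  rewrite /d /qinv_diff /= normrN; apply: le_trans (aux _) _.
  by apply: le_trans (ler_wpM2r (ltW C0) (aux' _)) _; rewrite -mulrA mulrC.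
move=> e e0; near=> h.
have hC : `|h| * C < 1 / 2.
  rewrite -ltr_pdivlMr//; near: h; apply: nbhs0_lt; rewrite !divr_gt0//.
have Wh : qregular (h + z).
  by apply: qregular_shift => //; apply: lt_trans hC _; lra.
have := qinv_sub Wz Wh; rewrite addrK /= -/q; set q' := qinv (h + z) => qq.
have q'q : `|q' - q| <= 2 * C * C * `|h|.
  have : `|q' - q| <= `|h| * (1 + `|q'|) * C.
    rewrite qq normrN; apply: le_trans (aux _) _; rewrite ler_wpM2r ?(ltW C0)//.
    by apply: le_trans (ler_normD _ _) _; rewrite mulrDr mulr1 lerD2l mulrC.
  have : `|q'| <= `|q| + `|q' - q| by rewrite -{1}(subrK q q') addrC ler_normD.
  have := ler_wpM2l (normr_ge0 (q' - q)) (ltW hC); have := normr_ge0 h; have := C0.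
  rewrite /C; move: (`|h|) (`|q|) (`|q'|) (`|q' - q|) => a b c d' C1 a0 hC' c1 c2.
  have := ler_wpM2l (mulr_ge0 a0 (ltW C1)) c1; lra.
have -> : q' - q - L h = - (m (q' - q) h + m (m (q' - q) h) q).
  pose k0 := h + m q h.
  have -> : m (q' - q) h = h + m q' h - k0.
    by rewrite /k0 opprD addrACA subrr add0r mDl mNl.
  rewrite {1}qq /= /d /qinv_diff /= -/k0 [m (_ - k0) q]mDl mNl.
  by rewrite opprK [in RHS]addrACA -[- k0 - _]opprD opprB [LHS]addrC.
rewrite normrN; apply: le_trans (aux _) _.
apply: (@le_trans _ _ (2 * C * C * `|h| * `|h| * C)).
  rewrite ler_wpM2r ?(ltW C0)//; apply: le_trans (mle _ _) _; exact: ler_wpM2r.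
have hs : `|h| <= e / (2 * C * C * C).
  by near: h; apply: nbhs0_le; rewrite divr_gt0// !mulr_gt0.
rewrite ler_pdivlMr in hs; last by rewrite !mulr_gt0.
apply: le_trans (ler_wpM2r (normr_ge0 h) hs).
by rewrite le_eqVlt; apply/orP; left; apply/eqP; ring.
Unshelve. all: by end_near. Qed.

Lemma smooth_qinv : smooth_on qregular qinv.
Proof.
apply: (smooth_bootstrap open_qregular _ is_diff_qinv).
have mC x y : `|m x y| <= 1 * `|x| * `|y| by rewrite mul1r.
have sm := smooth_bilinear mDl mDr mZl mZr mC.
have s1 : smooth_on setT (fst : E * E -> E) by exact: smooth_fst.
have s2 : smooth_on setT (snd : E * E -> E) by exact: smooth_snd.
have oT := @openT (E * E)%type.
have s3 : smooth_on setT (fun p : E * E => p.2 + m p.1 p.2).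
  by apply: smoothD => //; exact: (sm _ _ _ _ oT s1 s2).
by apply: smoothN => //; apply: smoothD => //; exact: (sm _ _ _ _ oT s3 s1).
Qed.

End QuasiInverse.

(** * Banach limits of bounded sequences *)

Section BanachLimit.
Variable R : realType.
Implicit Types s t : nat -> R.

Definition bounded_seq s := exists M : R, forall n, `|s n| <= M.

(** Compactness of [- M, M]: the image of the ultrafilter has a cluster point,
    and an ultrafilter converges to each of its cluster points. *)
Lemma ultra_bounded_cvg (U : set_system nat) s (M : R) : UltraFilter U ->
  (forall n, `|s n| <= M) -> exists2 l, `|l| <= M & s @ U --> l.
Proof.
move=> UU sM.
have [p []] : exists p, `[- M, M]%classic p /\ cluster (s @ U) p.
  apply: (@segment_compact R (- M) M).
  by apply: nearW => n; rewrite /= in_itv /= -ler_norml.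
rewrite /= in_itv /= -ler_norml => pM clp; exists p => //.
move=> N Np; have [//|UN] := in_ultra_setVsetC (s @^-1` N) UU.
have [x [h /= Nx]] := clp (~` N) N UN Np.
by have := h Nx.
Qed.

Definition cesaro s n := (\sum_(k < n.+1) s k) / n.+1%:R.

Lemma cesaro_bounded s (M : R) : (forall n, `|s n| <= M) -> forall n, `|cesaro s n| <= M.
Proof.
move=> sM n; rewrite normrM normfV ler_pdivrMr ?normr_gt0// (ger0_norm (ler0n _ _)).
rewrite (le_trans (ler_norm_sum _ _ _))//.
rewrite (le_trans (ler_sum _ (fun i _ => sM (nat_of_ord i))))//.
by rewrite sumr_const card_ord mulr_natr.
Qed.

(** Amenability of Z: ultrafilter limits of Cesaro means.  A shift moves the n-th
    mean of a bounded sequence by O(1/n), so the limit is shift-invariant. *)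
Lemma exists_banach_limit : exists L : (nat -> R) -> R,
  [/\ forall c s t, bounded_seq s -> bounded_seq t ->
        L (fun n => c * s n + t n) = c * L s + L t,
      forall s M, (forall n, `|s n| <= M) -> `|L s| <= M,
      forall s, bounded_seq s -> L (fun n => s n.+1) = L s &
      forall c, L (fun=> c) = c].
Proof.
have [U [UU ooU]] := @ultraFilterLemma nat \oo _.
pose L s := xget 0 [set l | cesaro s @ U --> l].
have LP s : bounded_seq s -> cesaro s @ U --> L s.
  move=> [M /cesaro_bounded /(ultra_bounded_cvg UU) [l _ sl]].
  by apply: (@xgetPex _ 0 [set l | cesaro s @ U --> l]); exists l.
have LE s l : bounded_seq s -> cesaro s @ U --> l -> L s = l.
  by move=> /LP sL; apply: cvg_unique sL; exact: norm_hausdorff.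
exists L; split.
- move=> c s t bs bt; apply: LE.
    have [[M sM] [M' tM]] := (bs, bt); exists (`|c| * M + M') => n.
    by apply: le_trans (ler_normD _ _) _; rewrite lerD// normrM ler_wpM2l.
  have -> : cesaro (fun n => c * s n + t n) = (fun n => c * cesaro s n + cesaro t n).
    apply/funext => n; rewrite /cesaro big_split /= -mulr_sumr; ring.
  apply: cvgD; [apply: cvgMr|]; exact: LP.
- move=> s M sM.
  have [l lM sl] := ultra_bounded_cvg UU (cesaro_bounded sM).
  by rewrite (LE _ l) //; exists M.
- move=> s bs; have [M sM] := bs.
  apply: LE; first by exists M => n.
  have -> : cesaro (fun n => s n.+1) =
      (fun n => cesaro s n + (s n.+1 - s 0) * harmonic n).
    apply/funext => n; rewrite /cesaro big_ord_recr /= [in RHS]big_ord_recl /=.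
    by under [X in _ = (_ + X) / _ + _]eq_bigr do rewrite /bump /=; ring.
  rewrite -[X in _ --> X]addr0; apply: cvgD; first exact: LP.
  have M0 : 0 <= M := le_trans (normr_ge0 (s 0)) (sM 0).
  have hM : 0 < M + M + 1 by rewrite ltr_wpDl// addr_ge0.
  apply/cvgrPdist_le => e e0; apply: ooU; near=> n.
  rewrite sub0r normrN normrM.
  apply: (@le_trans _ _ ((M + M) * harmonic n)).
    rewrite [`|harmonic n|]ger0_norm ?harmonic_ge0// ler_wpM2r ?harmonic_ge0//.
    by apply: le_trans (ler_normB _ _) _; rewrite lerD.
  apply: (@le_trans _ _ ((M + M + 1) * harmonic n)).
    by rewrite ler_wpM2r ?harmonic_ge0// lerDl.
  rewrite mulrC -ler_pdivlMr//.
  near: n; move/cvgrPdist_le: (@cvg_harmonic R) => /(_ (e / (M + M + 1)) (divr_gt0 e0 hM)).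
  by apply: filterS => n; rewrite sub0r normrN ger0_norm ?harmonic_ge0.
- move=> c; apply: LE; first by exists `|c|.
  have -> : cesaro (fun=> c) = fun=> c.
    apply/funext => n; rewrite /cesaro sumr_const card_ord -[c *+ _]mulr_natr mulfK//.
  exact: cvg_cst.
Unshelve. all: by end_near. Qed.
End BanachLimit.

(** * Geometry of the Hilbert space *)

Section HilbertBasics.
Variables (R : realType) (H : completeNormedModType R[i]).
Implicit Types h k : H.

Lemma normcE_C (c : R[i]) : `|c| = (Normc.normc c)%:C.
Proof. by []. Qed.

Lemma hnormE h : `|h| = (hnorm h)%:C.
Proof. by rewrite /hnorm RRe_real// normr_real. Qed.

Lemma hnorm_ge0 h : 0 <= hnorm h.
Proof. by rewrite -lecR -hnormE normr_ge0. Qed.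

Lemma hnormD h k : hnorm (h + k) <= hnorm h + hnorm k.
Proof. by rewrite -lecR rmorphD /= -!hnormE ler_normD. Qed.

Lemma hnormZ (c : R[i]) h : hnorm (c *: h) = Normc.normc c * hnorm h.
Proof. by apply: complexI; rewrite rmorphM /= -!hnormE normrZ. Qed.

Lemma hnormN h : hnorm (- h) = hnorm h.
Proof. by rewrite /hnorm normrN. Qed.

Lemma hnorm0 : hnorm (0 : H) = 0.
Proof. by rewrite /hnorm normr0. Qed.

Lemma hnorm_eq0 h : hnorm h = 0 -> h = 0.
Proof. by move=> h0; apply/normr0_eq0; rewrite hnormE h0. Qed.

Lemma hnormB h k : hnorm (h - k) = hnorm (k - h).
Proof. by rewrite -hnormN opprB. Qed.

Lemma hnorm_eq0_small h : (forall e : R, 0 < e -> hnorm h <= e) -> h = 0.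
Proof.
move=> hs; apply: hnorm_eq0; apply/eqP; rewrite eq_le hnorm_ge0 andbT.
by apply/ler_addgt0Pl => e e0; rewrite addr0 hs.
Qed.

(** The norm of [H] takes values in [R[i]]; this restates completeness through
    the real number [hnorm]. *)
Lemma hnorm_complete (u : nat -> H) :
  (forall e : R, 0 < e -> exists N, forall m n,
     (N <= m)%N -> (N <= n)%N -> hnorm (u m - u n) < e) ->
  exists l, forall e : R, 0 < e -> exists N, forall n, (N <= n)%N -> hnorm (l - u n) < e.
Proof.
move=> uC.
have cu : cvg (u @ \oo).
  apply/cauchy_cvgP/cauchy_ballP => e e0; have /complex_realP[r er] := gtr0_real e0.
  have r0 : 0 < r by rewrite -ltcR -er.
  have [N uN] := uC _ r0.
  exists (u @` [set n | (N <= n)%N], u @` [set n | (N <= n)%N]).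
    by split; exists N => // n Nn; exists n.
  move=> [_ _] [/= [m Nm <-] [n Nn <-]].
  by rewrite -ball_normE /= hnormE er ltcR uN.
exists (lim (u @ \oo)) => e e0.
have /cvgrPdist_lt /(_ e%:C) : u @ \oo --> lim (u @ \oo) by [].
rewrite ltcR => /(_ e0)[N _ uN]; exists N => n Nn.
by have := uN n Nn; rewrite /= hnormE ltcR.
Qed.

Section Dot.
Variable dot : {dot H for Num.conj}.
Hypothesis H_hilbert : is_hilbert dot.

Lemma dotDl h h' k : dot (h + h') k = dot h k + dot h' k.
Proof. exact: linearDl. Qed.
Lemma dotDr h k k' : dot h (k + k') = dot h k + dot h k'.
Proof. exact: linearDr. Qed.
Lemma dotNl h k : dot (- h) k = - dot h k.
Proof. exact: linearNl. Qed.
Lemma dotNr h k : dot h (- k) = - dot h k.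
Proof. exact: linearNr. Qed.
Lemma dotZl (c : R[i]) h k : dot (c *: h) k = c * dot h k.
Proof. exact: linearZl_LR. Qed.
Lemma dotZr (c : R[i]) h k : dot h (c *: k) = (Num.conj c) * dot h k.
Proof. exact: linearZr_LR. Qed.
Lemma dot0r h : dot h 0 = 0. Proof. exact: linear0r. Qed.
Lemma dotC h k : dot h k = Num.conj (dot k h).
Proof. by rewrite hermC expr0 mul1r. Qed.

Lemma hnorm_sqr h : (hnorm h ^+ 2)%:C = dot h h.
Proof. by rewrite rmorphXn /= -hnormE H_hilbert. Qed.

Lemma dot_inj h k : (forall f, dot h f = dot k f) -> h = k.
Proof.
move=> hk; apply/subr0_eq/hnorm_eq0.
have /eqP : hnorm (h - k) ^+ 2 = 0.
  by apply: complexI; rewrite hnorm_sqr dotDl dotNl hk subrr.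
by rewrite sqrf_eq0 => /eqP.
Qed.

(** Positivity of the square norm of (k, k) h - (h, k) k. *)
Lemma CauchySchwarz_hnorm h k : Normc.normc (dot h k) <= hnorm h * hnorm k.
Proof.
have [->|k0] := eqVneq k 0.
  by rewrite dot0r hnorm0 mulr0 Normc.normc0.
suff: `|dot h k| ^+ 2 <= (hnorm h * hnorm k)%:C ^+ 2.
  rewrite ler_pXn2r ?nnegrE ?normr_ge0 ?ler0c ?mulr_ge0 ?hnorm_ge0//.
  by rewrite normcE_C lecR.
have -> : (hnorm h * hnorm k)%:C ^+ 2 = dot h h * dot k k.
  by rewrite -!hnorm_sqr -rmorphM -rmorphXn /= exprMn.
have kr : Num.conj (dot k k) = dot k k by rewrite -hnorm_sqr conj_Creal ?complex_real.
have kk : 0 < dot k k by exact: neq0_dnorm_gt0.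
have : 0 <= dot (dot k k *: h - dot h k *: k) (dot k k *: h - dot h k *: k).
  by rewrite -hnorm_sqr ler0c sqr_ge0.
rewrite !(dotDl, dotDr, dotNl, dotNr, dotZl, dotZr) kr normCK [dot k h]dotC.
set c := dot h k; set d := dot k k; set u := dot h h.
have -> : d * (d * u) - d * (Num.conj c * c) - (c * (d * Num.conj c) - c * (Num.conj c * d))
  = d * (d * u - c * Num.conj c) by ring.
by rewrite pmulr_rge0// subr_ge0 [d * u]mulrC.
Qed.

Section Parseval.
Variable e : nat -> H.
Hypothesis e_onb : orthonormal_basis dot e.

Definition fourier_sum h n := \sum_(0 <= i < n) dot h (e i) *: e i.

Let dot_suml I (r : seq I) (P : pred I) (F : I -> H) k :
  dot (\sum_(i <- r | P i) F i) k = \sum_(i <- r | P i) dot (F i) k.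
Proof. exact: linear_sumlz. Qed.
Let dot_sumr I (r : seq I) (P : pred I) (F : I -> H) k :
  dot k (\sum_(i <- r | P i) F i) = \sum_(i <- r | P i) dot k (F i).
Proof. exact: linear_sumr. Qed.

Lemma dot_fourier_sum h n m : (m < n)%N -> dot (fourier_sum h n) (e m) = dot h (e m).
Proof.
move=> mn; rewrite dot_suml; under eq_bigr do rewrite dotZl e_onb.1.
rewrite (bigD1_seq m) ?mem_index_iota ?iota_uniq//= eqxx mulr1 big1 ?addr0// => i /negPf im.
by rewrite im mulr0.
Qed.

Let S h n : R := \sum_(0 <= i < n) Normc.normc (dot h (e i)) ^+ 2.

Let SE h n : (S h n)%:C = \sum_(0 <= i < n) dot h (e i) * Num.conj (dot h (e i)).
Proof.
by rewrite rmorph_sum; apply: eq_bigr => i _; rewrite rmorphXn /= -normcE_C normCK.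
Qed.

Let dot_fourier2 h n m : (m <= n)%N ->
  dot (fourier_sum h n) (fourier_sum h m) = (S h m)%:C.
Proof.
move=> mn; rewrite SE dot_sumr; apply: eq_big_nat => i /andP[_ im].
by rewrite dotZr dot_fourier_sum ?(leq_trans im)// mulrC.
Qed.

Let dot_fourier_r h n : dot h (fourier_sum h n) = (S h n)%:C.
Proof. by rewrite SE dot_sumr; apply: eq_bigr => i _; rewrite dotZr mulrC. Qed.

Let S_real h n : Num.conj (S h n)%:C = (S h n)%:C.
Proof. by rewrite conj_Creal// complex_real. Qed.

Let hnorm_fourier h n m : (m <= n)%N ->
  hnorm (fourier_sum h n - fourier_sum h m) ^+ 2 = S h n - S h m.
Proof.
move=> mn; apply: complexI; rewrite hnorm_sqr !(dotDl, dotDr, dotNl, dotNr).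
rewrite [dot (fourier_sum h m) (fourier_sum h n)]dotC !dot_fourier2// S_real.
rewrite rmorphB /=; ring.
Qed.

Let bessel h n : S h n <= hnorm h ^+ 2.
Proof.
rewrite -lecR hnorm_sqr -subr_ge0.
have -> : dot h h - (S h n)%:C = dot (h - fourier_sum h n) (h - fourier_sum h n).
  rewrite !(dotDl, dotDr, dotNl, dotNr) [dot (fourier_sum h n) h]dotC.
  rewrite dot_fourier2// !dot_fourier_r S_real; ring.
by rewrite -hnorm_sqr ler0c sqr_ge0.
Qed.

(** By Bessel's inequality the Fourier sums are Cauchy; their limit has the same
    coefficients as h, so totality of the basis makes it equal to h. *)
Lemma fourier_sum_cvg h (eps : R) : 0 < eps ->
  exists N, forall n, (N <= n)%N -> hnorm (h - fourier_sum h n) < eps.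
Proof.
move=> eps0.
have SC : cvgn (S h).
  apply: nondecreasing_is_cvgn; last by exists (hnorm h ^+ 2) => _ [n _ <-]; exact: bessel.
  by apply/nondecreasing_seqP => n; rewrite /S big_nat_recr//= lerDl sqr_ge0.
have [|l lP] := @hnorm_complete (fourier_sum h).
  move=> d d0.
  have /cvgrPdist_lt /(_ (d ^+ 2 / 2)) [] : S h @ \oo --> limn (S h) by [].
    by rewrite divr_gt0// exprn_gt0.
  move=> N _ SN; exists N => m n.
  wlog nm : m n / (n <= m)%N.
    by move=> W Nm Nn; case/orP: (leq_total n m) => [/W|/W]; [exact|rewrite hnormB; exact].
  move=> Nm Nn; rewrite -(ltr_pXn2r (ltn0Sn 1)) ?nnegrE ?hnorm_ge0 ?(ltW d0)// hnorm_fourier//.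
  have := SN _ Nm; have := SN _ Nn; rewrite /= !ltr_norml; lra.
suff hl : h = l.
  by have [N lN] := lP _ eps0; exists N => n /lN; rewrite {2}hl.
apply/subr0_eq/e_onb.2 => m; apply: Normc.eq0_normc; apply/eqP.
rewrite eq_le [X in _ && X](_ : _ = true) ?andbT; last by rewrite -ler0c -normcE_C normr_ge0.
apply/ler_addgt0Pl => d d0; rewrite addr0.
have [N lN] := lP d d0; set n := maxn N m.+1.
have -> : dot (h - l) (e m) = dot (fourier_sum h n - l) (e m).
  by rewrite !(dotDl, dotNl) dot_fourier_sum// leq_maxr.
apply: le_trans (CauchySchwarz_hnorm _ _) _.
have -> : hnorm (e m) = 1.
  apply/eqP; rewrite -(eqrXn2 (ltn0Sn 1)) ?hnorm_ge0// expr1n; apply/eqP/complexI.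
  by rewrite hnorm_sqr e_onb.1 eqxx.
by rewrite mulr1 hnormB; apply/ltW/lN; rewrite leq_maxl.
Qed.

End Parseval.

End Dot.
End HilbertBasics.

(** * Bounded operators and symmetrically normed ideals *)

Section BoundedOperators.
Variables (R : realType) (H : completeNormedModType R[i]).
Implicit Types a b x : H -> H.

Lemma bounded_op_le a : bounded_op a ->
  exists2 M : R, 0 <= M & forall h, hnorm (a h) <= M * hnorm h.
Proof.
move=> [_ [M aM]]; exists `|M| => // h; apply: le_trans (aM h) _.
by rewrite ler_wpM2r ?hnorm_ge0// ler_norm.
Qed.

Lemma bounded_op_id : bounded_op (id : H -> H).
Proof. by split=> //; exists 1 => h; rewrite mul1r. Qed.

Lemma bounded_opD a b : bounded_op a -> bounded_op b -> bounded_op (a + b).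
Proof.
move=> ba bb; split.
  by move=> r x y; rewrite !fctE ba.1 bb.1 scalerDr addrACA.
have [[M M0 aM] [N N0 bN]] := (bounded_op_le ba, bounded_op_le bb).
exists (M + N) => h; rewrite fctE mulrDl; apply: le_trans (hnormD _ _) _.
exact: lerD.
Qed.

Lemma bounded_opZ (c : R[i]) a : bounded_op a -> bounded_op (c *: a).
Proof.
move=> ba; split.
  by move=> r x y; rewrite !fctE ba.1 scalerDr !scalerA mulrC.
have [M M0 aM] := bounded_op_le ba.
exists (Normc.normc c * M) => h; rewrite fctE hnormZ -mulrA ler_wpM2l//.
by rewrite -lecR -normcE_C normr_ge0.
Qed.

Lemma opnorm_le a (M : R) : 0 <= M -> (forall h, hnorm (a h) <= M * hnorm h) -> opnorm a <= M.
Proof.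
move=> M0 aM; apply: sup_le_ub; first by exists (hnorm (a 0)); exists 0 => //=; rewrite hnorm0.
move=> _ [h /= h1 <-]; apply: le_trans (aM h) _.
by rewrite -[leRHS]mulr1 ler_wpM2l.
Qed.

Lemma lin0 a : linear a -> a 0 = 0.
Proof. by move=> la; have := la (-1) 0 0; rewrite !scaleN1r addr0 oppr0 addNr. Qed.
Lemma linD a h k : linear a -> a (h + k) = a h + a k.
Proof. by move=> la; rewrite -[h]scale1r la !scale1r. Qed.
Lemma linZ a (c : R[i]) h : linear a -> a (c *: h) = c *: a h.
Proof. by move=> la; rewrite -[c *: h]addr0 la (lin0 la) !addr0. Qed.
Lemma linN a h : linear a -> a (- h) = - a h.
Proof. by move=> la; rewrite -scaleN1r linZ// scaleN1r. Qed.

Lemma normc_ge0r (r : R) : 0 <= r -> Normc.normc r%:C = r.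
Proof. by move=> r0; rewrite /= expr0n addr0 sqrtr_sqr ger0_norm. Qed.

Variable dot : {dot H for Num.conj}.
Hypothesis H_hilbert : is_hilbert dot.

Definition rank1 (k g : H) : H -> H := fun f => dot f k *: g.

Lemma rank1_le k g h : hnorm (rank1 k g h) <= hnorm k * hnorm g * hnorm h.
Proof.
rewrite /rank1 hnormZ; apply: le_trans (ler_wpM2r (hnorm_ge0 _) (CauchySchwarz_hnorm H_hilbert _ _)) _.
by rewrite [_ * hnorm k]mulrC mulrAC.
Qed.

Lemma bounded_rank1 k g : bounded_op (rank1 k g).
Proof.
split; last by exists (hnorm k * hnorm g) => h; exact: rank1_le.
by move=> r x y; rewrite /rank1 dotDl dotZl scalerDl scalerA.
Qed.

Lemma hnorm_scale_unit (g : H) : g <> 0 -> hnorm (((hnorm g)^-1)%:C *: g) = 1.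
Proof.
move=> /eqP g0; have gn0 : hnorm g != 0 by apply: contra_neq g0; exact: hnorm_eq0.
by rewrite hnormZ normc_ge0r ?invr_ge0 ?hnorm_ge0// mulVf.
Qed.

Lemma dot_unit (e : H) : hnorm e = 1 -> dot e e = 1.
Proof. by move=> e1; rewrite -hnorm_sqr// e1 expr1n. Qed.

Section Ideal.
Variable J : normedSubspace (H -> H).
Hypothesis sJ : symm_normed_ideal dot J.

Lemma J_ge0 x : J x -> 0 <= ns_norm J x.
Proof. by move=> Jx; exact: (normr_ge0 (Elt Jx : elt J)). Qed.

(** Contractions on both sides do not increase the norm of the ideal; this is
    how conjugation by unitaries will be bounded. *)
Lemma J_conj a x b : bounded_op a -> J x -> bounded_op b ->
  (forall h, hnorm (a h) <= hnorm h) -> (forall h, hnorm (b h) <= hnorm h) ->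
  J (a \o x \o b) /\ ns_norm J (a \o x \o b) <= ns_norm J x.
Proof.
move=> ba Jx bb a1 b1; have [Jaxb ab] := sni_ideal sJ ba Jx bb; split=> //.
have oa : opnorm a <= 1 by apply: opnorm_le => // h; rewrite mul1r.
have ob : opnorm b <= 1 by apply: opnorm_le => // h; rewrite mul1r.
have J0 := J_ge0 Jx.
have n0 (c : H -> H) : bounded_op c -> 0 <= opnorm c.
  move=> bc; have [M M0 cM] := bounded_op_le bc.
  rewrite -(hnorm0 H) -{1}(lin0 bc.1); apply: ub_le_sup.
    exists M => _ [h /= h1 <-]; apply: le_trans (cM h) _.
    by rewrite -[leRHS]mulr1 ler_wpM2l.
  by exists 0 => //=; rewrite hnorm0.
apply: le_trans ab _; rewrite -[leRHS]mulr1 ler_pM ?mulr_ge0 ?n0//.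
by rewrite -[leRHS]mul1r ler_pM ?n0.
Qed.

Lemma unit_vector : exists e : H, hnorm e = 1.
Proof.
have [x Jx x0] := sni_neq0 sJ.
have [h h0] : exists h, x h <> 0.
  apply: contrapT => nx; apply: x0; apply/funext => h.
  by apply: contrapT => xh; apply: nx; exists h.
by exists (((hnorm (x h))^-1)%:C *: x h); exact: hnorm_scale_unit.
Qed.

Lemma J_rank1 k g : J (rank1 k g).
Proof.
have [e e1] := unit_vector.
have := (sni_ideal sJ (bounded_rank1 e g) (sni_rank1 sJ e1).1 (bounded_rank1 k e)).1.
have -> // : rank1 e g \o (fun h => dot h e *: e) \o rank1 k e = rank1 k g.
by apply/funext => f; rewrite /= /rank1 !dotZl dot_unit// !mulr1.
Qed.

(** The ideal norm dominates the operator norm: for a unit vector e with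
    x e = r f and f a unit vector, composing x with the operator of rank one
    that sends f to e gives r times the projection onto f, whose ideal norm
    is r. *)
Lemma J_hnorm_le x h : J x -> hnorm (x h) <= ns_norm J x * hnorm h.
Proof.
move=> Jx; have lx := (sni_bounded sJ Jx).1.
suff unit_le e : hnorm e = 1 -> hnorm (x e) <= ns_norm J x.
  have [->|/eqP h0] := eqVneq h 0; first by rewrite (lin0 lx) hnorm0 mulr0.
  have h1 : 0 < hnorm h.
    by rewrite lt_def hnorm_ge0 andbT; apply/eqP => /hnorm_eq0.
  have := unit_le _ (hnorm_scale_unit h0); rewrite linZ// hnormZ.
  rewrite normc_ge0r ?invr_ge0 ?(ltW h1)//.
  by rewrite ler_pdivrMl// mulrC.
move=> e1; have [->|/eqP g0] := eqVneq (x e) 0; first by rewrite hnorm0 J_ge0.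
have f1 := hnorm_scale_unit g0; set f := _ *: x e in f1.
have gf : x e = (hnorm (x e))%:C *: f.
  rewrite scalerA -rmorphM mulfV ?scale1r//; apply/eqP => /hnorm_eq0; exact: g0.
have [] := @J_conj id x (rank1 f e) bounded_op_id Jx (bounded_rank1 _ _).
- by [].
- by move=> h'; apply: le_trans (rank1_le _ _ _) _; rewrite f1 e1 !mul1r.
- have -> : id \o x \o rank1 f e = (hnorm (x e))%:C *: (fun h => dot h f *: f).
    apply/funext => v; rewrite /= /rank1 linZ// {1}gf fctE !scalerA; congr (_ *: _).
    by rewrite [dot v f * _]mulrC.
  move=> _; rewrite (sni_scale sJ _ (sni_rank1 sJ f1).1).2 (sni_rank1 sJ f1).2 mulr1.
  by rewrite normc_ge0r ?hnorm_ge0.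
Qed.

End Ideal.
End BoundedOperators.

(** * Trace duality and averages over unitary orbits *)

Section ComplexBanachLimit.
Variable R : realType.
Implicit Types s t : nat -> R[i].

Definition bounded_cseq s := exists M : R, forall n, Normc.normc (s n) <= M.

Lemma Re_le_normc (c : R[i]) : `|complex.Re c| <= Normc.normc c.
Proof. by rewrite -lecR; exact: normc_ge_Re. Qed.

Lemma Im_le_normc (c : R[i]) : `|complex.Im c| <= Normc.normc c.
Proof.
by case: c => a b /=; rewrite -sqrtr_sqr ler_wsqrtr// lerDr sqr_ge0.
Qed.

Lemma normc_le_ReIm (c : R[i]) : Normc.normc c <= `|complex.Re c| + `|complex.Im c|.
Proof.
case: c => a b /=; rewrite -[leRHS]ger0_norm ?addr_ge0// -sqrtr_sqr ler_wsqrtr//.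
by rewrite sqrrD !real_normK ?num_real// addrAC lerDl mulrn_wge0 ?mulr_ge0.
Qed.

(** Real and imaginary parts are treated separately, whence the factor 2 in the
    bound. *)
Lemma exists_complex_banach_limit : exists L : (nat -> R[i]) -> R[i],
  [/\ forall c s t, bounded_cseq s -> bounded_cseq t ->
        L (fun n => c * s n + t n) = c * L s + L t,
      forall s (M : R), (forall n, Normc.normc (s n) <= M) -> Normc.normc (L s) <= M + M,
      forall s, bounded_cseq s -> L (fun n => s n.+1) = L s,
      forall c, L (fun=> c) = c &
      forall s, bounded_cseq s -> L (fun n => Num.conj (s n)) = Num.conj (L s)].
Proof.
have [L [Llin Lb Ls Lc]] := exists_banach_limit R.
have bRe s : bounded_cseq s -> bounded_seq (fun n => complex.Re (s n)).
  by move=> [M sM]; exists M => n; apply: le_trans (Re_le_normc _) _.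
have bIm s : bounded_cseq s -> bounded_seq (fun n => complex.Im (s n)).
  by move=> [M sM]; exists M => n; apply: le_trans (Im_le_normc _) _.
have b0 : bounded_seq (fun=> 0 : R) by exists 0 => n; rewrite normr0.
have bZ (a : R) (s t : nat -> R) : bounded_seq s -> bounded_seq t -> bounded_seq (fun n => a * s n + t n).
  move=> [M sM] [N tN]; exists (`|a| * M + N) => n.
  by apply: le_trans (ler_normD _ _) _; rewrite lerD// normrM ler_wpM2l.
exists (fun s => L (fun n => complex.Re (s n)) +i* L (fun n => complex.Im (s n))); split.
- move=> [a b] s t bs bt.
  have -> : (fun n => complex.Re ((a +i* b) * s n + t n)) =
      (fun n => a * complex.Re (s n) + (- b * complex.Im (s n) + complex.Re (t n))).
    by apply/funext => n; case: (s n) (t n) => [? ?] [? ?] /=; ring.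
  have -> : (fun n => complex.Im ((a +i* b) * s n + t n)) =
      (fun n => a * complex.Im (s n) + (b * complex.Re (s n) + complex.Im (t n))).
    by apply/funext => n; case: (s n) (t n) => [? ?] [? ?] /=; ring.
  rewrite !Llin; try by [apply: bRe|apply: bIm|apply: bZ; [apply: bRe|apply: bIm]|
    apply: bZ; [apply: bIm|apply: bRe]].
  by apply/eqP; rewrite eq_complex /=; apply/andP; split; apply/eqP; ring.
- move=> s M sM; apply: le_trans (normc_le_ReIm _) _ => /=.
  by rewrite lerD//; apply: Lb => n; [apply: le_trans (Re_le_normc _) _|apply: le_trans (Im_le_normc _) _].
- by move=> s bs; rewrite (Ls _ (bRe _ bs)) (Ls _ (bIm _ bs)).
- by move=> [a b]; rewrite /= !Lc.
- move=> s bs.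
  have Lc' (z : R[i]) : Num.conj z = complex.Re z -i* complex.Im z.
    by case: z => a b.
  rewrite Lc' /=; apply/eqP; rewrite eq_complex /=; apply/andP; split; apply/eqP.
    by congr L; apply/funext => n; rewrite Lc'.
  transitivity (L (fun n => -1 * complex.Im (s n) + 0)).
    by congr L; apply/funext => n; rewrite Lc' /= addr0 mulN1r.
  by rewrite Llin ?Lc ?addr0 ?mulN1r//; exact: bIm.
Qed.

End ComplexBanachLimit.

Lemma ns_norm0 (R : realType) (V : lmodType R[i]) (S : normedSubspace V) : ns_norm S 0 = 0.
Proof. exact: (normr0 (elt S)). Qed.

Section TraceDuality.
Variables (R : realType) (H : completeNormedModType R[i]).
Variable dot : {dot H for Num.conj}.
Hypothesis H_hilbert : is_hilbert dot.

Lemma normc_nonneg (c : R[i]) : 0 <= Normc.normc c.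
Proof. by rewrite -lecR -normcE_C normr_ge0. Qed.

(** The partial sums of the trace are << s_N, k >> for the Fourier sums s_N of
    z g.  Pairing with operators of rank one thus recovers the matrix
    coefficients of z. *)
Lemma Tr_rank1 (z : H -> H) k g : orthonormal_basis dot (onb dot) -> linear z ->
  Tr dot (z \o rank1 dot k g) = dot (z g) k.
Proof.
move=> eb lz; set e := onb dot in eb *.
pose w N := dot (fourier_sum dot e (z g) N) k.
have wE N : w N = \sum_(0 <= n < N) dot ((z \o rank1 dot k g) (e n)) (e n).
  rewrite /w /fourier_sum [LHS]linear_sumlz; apply: eq_bigr => n _ /=.
  by rewrite /rank1 linZ// !dotZl mulrC.
have wcvg (p : R[i] -> R) : (forall c d, p (c - d) = p c - p d) ->
    (forall c, `|p c| <= Normc.normc c) -> (fun N => p (w N)) @ \oo --> p (dot (z g) k).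
  move=> pB pn; apply/cvgrPdist_le => eps eps0.
  have k0 : 0 < hnorm k + 1 by rewrite ltr_wpDl ?hnorm_ge0.
  have [N hN] := fourier_sum_cvg H_hilbert eb (z g) (divr_gt0 eps0 k0).
  exists N => // n /= Nn; rewrite -pB; apply: le_trans (pn _) _.
  rewrite /w -dotNl -dotDl; apply: le_trans (CauchySchwarz_hnorm H_hilbert _ _) _.
  apply: (@le_trans _ _ (eps / (hnorm k + 1) * (hnorm k + 1))); last by rewrite divfK// gt_eqF.
  by rewrite ler_pM ?hnorm_ge0// ?(ltW (hN _ Nn))// lerDl.
have limE (p : R[i] -> R) : (forall c d, p (c - d) = p c - p d) -> p 0 = 0 ->
    (forall c d, p (c + d) = p c + p d) ->
    (forall c, `|p c| <= Normc.normc c) ->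
    limn (series (fun n => p (dot ((z \o rank1 dot k g) (e n)) (e n)))) = p (dot (z g) k).
  move=> pB p0 pD pn; have -> : series (fun n => p (dot ((z \o rank1 dot k g) (e n)) (e n))) =
      (fun N => p (w N)).
    by apply/funext => N; rewrite wE /series /=; apply/esym/big_morph.
  by apply: cvg_lim; [exact: norm_hausdorff|exact: wcvg].
have ReD (c d : R[i]) : complex.Re (c + d) = complex.Re c + complex.Re d by case: c d => [? ?] [].
have ReB (c d : R[i]) : complex.Re (c - d) = complex.Re c - complex.Re d by case: c d => [? ?] [].
have ImD (c d : R[i]) : complex.Im (c + d) = complex.Im c + complex.Im d by case: c d => [? ?] [].
have ImB (c d : R[i]) : complex.Im (c - d) = complex.Im c - complex.Im d by case: c d => [? ?] [].
rewrite /Tr (limE (@complex.Re R) ReB erefl ReD (@Re_le_normc R)).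
rewrite (limE (@complex.Im R) ImB erefl ImD (@Im_le_normc R)).
by case: (dot _ _).
Qed.

Section DualPair.
Variables J J1 : normedSubspace (H -> H).
Hypothesis JJ1 : dual_pair dot J J1.
Let sJ := dp_ideal JJ1.
Let sJ1 := dp_ideal1 JJ1.

(** If there were no orthonormal basis, the sequence chosen as [onb] would be 0
    and the trace would vanish; the isometric duality would then make the norm
    of [J] vanish, although [J] is not zero. *)
Lemma onb_orthonormal : orthonormal_basis dot (onb dot).
Proof.
apply: contrapT => neb.
have onb0 : onb dot = fun=> 0.
  by rewrite /onb; apply: xgetPN => e eb; apply: neb; apply: xgetPex; exists e.
have [x Jx x0] := sni_neq0 sJ.
have Tr0 T : Tr dot T = 0.
  rewrite /Tr onb0 -[RHS]/(0 +i* 0); congr (_ +i* _).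
    rewrite (_ : series _ = fun=> 0) ?lim_cst//; apply/funext => n.
    by rewrite /series /= big1// => i _; rewrite dot0r.
  rewrite (_ : series _ = fun=> 0) ?lim_cst//; apply/funext => n.
  by rewrite /series /= big1// => i _; rewrite dot0r.
apply: x0; apply: (ns_norm_eq0 Jx); rewrite -(dp_isometry JJ1 Jx).2.
rewrite /functional_norm (_ : [set _ | _ in _] = [set 0]) ?sup1//.
apply/seteqP; split=> [_ [y _ <-]|_ ->]; first by rewrite Tr0 Normc.normc0.
exists 0; first by split; [exact: ns_0|rewrite ns_norm0].
by rewrite Tr0 Normc.normc0.
Qed.

Lemma functional_le phi y : bounded_functional J1 phi -> J1 y ->
  Normc.normc (phi y) <= functional_norm J1 phi * ns_norm J1 y.
Proof.
move=> [philin [M phiM]] J1y.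
have phi0 : phi 0 = 0.
  have := philin (-1) 0 0 (ns_0 J1) (ns_0 J1).
  by rewrite scaleN1r oppr0 addr0 mulN1r addNr.
have [y0|y0] := eqVneq (ns_norm J1 y) 0.
  by rewrite (ns_norm_eq0 J1y y0) phi0 Normc.normc0 -(ns_norm_eq0 J1y y0) y0 mulr0.
have yp : 0 < ns_norm J1 y by rewrite lt_def y0 (J_ge0 J1y).
rewrite -ler_pdivrMr//.
have J1z := @ns_Z _ _ J1 (ns_norm J1 y)^-1 _ J1y.
have phiZ : phi (((ns_norm J1 y)^-1)%:C *: y) = ((ns_norm J1 y)^-1)%:C * phi y.
  by have := philin ((ns_norm J1 y)^-1)%:C y 0 J1y (ns_0 J1); rewrite addr0 phi0 addr0.
apply: ub_le_sup.
  exists `|M| => _ [z [J1z' z1] <-]; apply: le_trans (phiM _ J1z') _.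
  apply: (@le_trans _ _ (`|M| * ns_norm J1 z)); first by rewrite ler_wpM2r ?(J_ge0 J1z')// ler_norm.
  by rewrite -[leRHS]mulr1 ler_wpM2l.
exists (((ns_norm J1 y)^-1)%:C *: y).
  by split=> //; rewrite ns_normZ// ger0_norm ?invr_ge0 ?(ltW yp)// mulVf.
by rewrite phiZ Normc.normcM normc_ge0r ?invr_ge0 ?(ltW yp)// mulrC.
Qed.

Section Mean.
Variables u u' : H -> H.
Hypothesis bu : bounded_op u.
Hypothesis bu' : bounded_op u'.
Hypothesis uu' : u \o u' = id.
Hypothesis u'u : u' \o u = id.
Hypothesis adju : adjoint dot u u'.

Let uK h : u' (u h) = h. Proof. exact: (congr1 (@^~ h) u'u). Qed.
Let u'K h : u (u' h) = h. Proof. exact: (congr1 (@^~ h) uu'). Qed.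
Let adju' h k : dot (u' h) k = dot h (u k).
Proof. by rewrite -{2}(u'K h) adju uK. Qed.

Let u_iso h : hnorm (u h) = hnorm h.
Proof.
apply/eqP; rewrite -(eqrXn2 (ltn0Sn 1)) ?hnorm_ge0//; apply/eqP/complexI.
by rewrite !(hnorm_sqr H_hilbert) adju uK.
Qed.
Let u'_iso h : hnorm (u' h) = hnorm h.
Proof. by rewrite -u_iso u'K. Qed.

Definition orbit_conj n (x : H -> H) := iter n (fun z => u \o z \o u') x.

Lemma orbit_conj_J n x : J x -> J (orbit_conj n x) /\ ns_norm J (orbit_conj n x) <= ns_norm J x.
Proof.
move=> Jx; elim: n => //= n [Jn xn].
have [|| ? ?] := J_conj sJ bu Jn bu'.
- by move=> h; rewrite u_iso.
- by move=> h; rewrite u'_iso.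
- by split=> //; apply: le_trans xn.
Qed.

Variable L : (nat -> R[i]) -> R[i].
Hypothesis Llin : forall c s t, bounded_cseq s -> bounded_cseq t ->
  L (fun n => c * s n + t n) = c * L s + L t.
Hypothesis Lb : forall s (M : R), (forall n, Normc.normc (s n) <= M) ->
  Normc.normc (L s) <= M + M.

(** The weak-* mean of the orbit of x: y |-> L (Tr (u^n x u^-n y)) is a bounded
    functional on [J1], hence given by an element of [J].  Operators y of rank
    one identify its matrix coefficients. *)
Lemma orbit_mean_exists x : J x -> exists y, [/\ J y, ns_norm J y <= ns_norm J x + ns_norm J x &
  forall h k, dot (y h) k = L (fun n => dot (orbit_conj n x h) k)].
Proof.
move=> Jx.
pose phi y := L (fun n => Tr dot (orbit_conj n x \o y)).
have TrB n y : J1 y -> Normc.normc (Tr dot (orbit_conj n x \o y)) <= ns_norm J x * ns_norm J1 y.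
  move=> J1y; have [Jn xn] := orbit_conj_J n Jx.
  have [bf fn] := dp_isometry JJ1 Jn.
  apply: le_trans (functional_le bf J1y) _.
  by rewrite fn ler_wpM2r ?(J_ge0 J1y).
have Tb y : J1 y -> bounded_cseq (fun n => Tr dot (orbit_conj n x \o y)).
  by move=> J1y; exists (ns_norm J x * ns_norm J1 y) => n; exact: TrB.
have phib y : J1 y -> Normc.normc (phi y) <= (ns_norm J x + ns_norm J x) * ns_norm J1 y.
  by move=> J1y; rewrite mulrDl; apply: Lb => n; exact: TrB.
have bphi : bounded_functional J1 phi.
  split; last by exists (ns_norm J x + ns_norm J x).
  move=> c y z J1y J1z; rewrite /phi -(Llin _ (Tb _ J1y) (Tb _ J1z)); congr L.
  apply/funext => n; have [Jn _] := orbit_conj_J n Jx.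
  exact: ((dp_isometry JJ1 Jn).1.1 c y z J1y J1z).
have [y Jy yE] := dp_onto JJ1 bphi; exists y; split=> //.
  rewrite -(dp_isometry JJ1 Jy).2; apply: sup_le_ub.
    by exists (Normc.normc (Tr dot (y \o 0))); exists 0 => //; split; [exact: ns_0|rewrite ns_norm0].
  move=> _ [z [J1z z1] <-]; rewrite -yE//; apply: le_trans (phib _ J1z) _.
  by rewrite -[leRHS]mulr1 ler_wpM2l ?addr_ge0 ?(J_ge0 Jx).
move=> h k; have Jr := J_rank1 H_hilbert sJ1 k h.
rewrite -(Tr_rank1 k h onb_orthonormal (sni_bounded sJ Jy).1) -yE// /phi.
congr L; apply/funext => n; have [Jn _] := orbit_conj_J n Jx.
exact: (Tr_rank1 k h onb_orthonormal (sni_bounded sJ Jn).1).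
Qed.

End Mean.
End DualPair.
End TraceDuality.

(** * Cayley transforms of small skew operators *)

Lemma double_inj (K : numFieldType) (V : lmodType K) (a b : V) : a + a = b + b -> a = b.
Proof.
have half (c : V) : c = 2^-1 *: (c + c).
  by rewrite -[c + c]mulr2n -[c *+ 2]scaler_nat scalerA mulVf ?scale1r ?pnatr_eq0.
by move=> ab; rewrite (half a) ab -half.
Qed.

Section Cayley.
Variables (R : realType) (H : completeNormedModType R[i]).

(** The partial Neumann sums y_n = k + T y_(n-1) are bounded by 2 |k|, and
    y_(n+p) - y_n = T^n y_p, so they form a Cauchy sequence. *)
Lemma neumann (T : H -> H) : linear T -> (forall h, hnorm (T h) <= 2^-1 * hnorm h) ->
  forall k, exists h, h - T h = k.
Proof.
move=> lT Th k; pose y n := iter n (fun h => k + T h) 0.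
have TB h h' : T (h - h') = T h - T h' by rewrite linD// linN.
have yle n : hnorm (y n) <= 2 * hnorm k.
  elim: n => [|n IH]; first by rewrite /= hnorm0 mulr_ge0 ?hnorm_ge0.
  apply: le_trans (hnormD _ _) _; have := Th (y n); have := hnorm_ge0 k; lra.
have ydist n p : hnorm (y (n + p)%N - y n) <= 2^-1 ^+ n * (2 * hnorm k).
  elim: n => [|n IH]; first by rewrite add0n subr0 expr0 mul1r.
  rewrite addSn /= opprD addrACA subrr add0r -TB exprS -mulrA.
  by apply: le_trans (Th _) _; rewrite ler_wpM2l// invr_ge0.
have small (e : R) : 0 < e -> exists N, forall n, (N <= n)%N -> 2^-1 ^+ n * (2 * hnorm k) < e.
  move=> e0; have k0 : 0 < 2 * hnorm k + 1 by rewrite ltr_wpDl ?mulr_ge0 ?hnorm_ge0.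
  have /cvgrPdist_lt /(_ _ (divr_gt0 e0 k0)) [N _ hN] :
      (fun n => 2^-1 ^+ n : R) @ \oo --> 0 by apply: cvg_expr; rewrite ger0_norm// invf_lt1// ltr1n.
  exists N => n /hN; rewrite /= sub0r normrN ger0_norm ?exprn_ge0 ?invr_ge0// ltr_pdivlMr//.
  apply: le_lt_trans; rewrite ler_wpM2l ?exprn_ge0 ?invr_ge0// lerDl//.
have [|l ly] := @hnorm_complete R H y.
  move=> e /small [N hN]; exists N => m n.
  wlog nm : m n / (n <= m)%N.
    by move=> W Nm Nn; case/orP: (leq_total n m) => [/W|/W]; [exact|rewrite hnormB; exact].
  by move=> Nm Nn; rewrite -(subnKC nm); apply: le_lt_trans (ydist _ _) (hN _ Nn).
exists l; apply/subr0_eq/hnorm_eq0_small => e e0.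
have [N hN] := ly (e / 2) (divr_gt0 e0 (ltr0Sn _ _)).
have -> : l - T l - k = (l - y N.+1) - T (l - y N).
  by rewrite TB /= opprB opprD !addrA subrK addrAC.
apply: le_trans (hnormD _ _) _; rewrite hnormN.
have := Th (l - y N); have := hN N (leqnn N); have := hN N.+1 (leqnSn N); have := hnorm_ge0 (l - y N).
lra.
Qed.

Variable dot : {dot H for Num.conj}.
Hypothesis H_hilbert : is_hilbert dot.

Record unitary_pair (u u' : H -> H) : Prop := UnitaryPair {
  up_bounded : bounded_op u;
  up_bounded' : bounded_op u';
  up_K : u' \o u = id;
  up_K' : u \o u' = id;
  up_adj : adjoint dot u u' }.

(** u = (1 + T) (1 - T)^-1 preserves the inner product since T is skew.  As
    u = 2 (1 - T)^-1 - 1, commuting with u means commuting with (1 - T)^-1,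
    that is, with T. *)
Lemma cayley_unitary_pair (T : H -> H) : linear T ->
  (forall h, hnorm (T h) <= 2^-1 * hnorm h) ->
  (forall h k, dot (T h) k = - dot h (T k)) ->
  exists u u', unitary_pair u u' /\
    forall x, linear x -> (x \o u = u \o x <-> x \o T = T \o x).
Proof.
move=> lT Th skT.
have lT' : linear (- T).
  by move=> c h k; rewrite !fctE lT opprD scalerN.
have T'h h : hnorm ((- T) h) <= 2^-1 * hnorm h by rewrite fctE hnormN.
have inj (A : H -> H) h h' : linear A -> (forall h, hnorm (A h) <= 2^-1 * hnorm h) ->
    h - A h = h' - A h' -> h = h'.
  move=> lA Ah hh; apply/subr0_eq/hnorm_eq0.
  have : h - h' = A (h - h').
    rewrite (linD _ _ lA) (linN _ lA); have {1}-> : h = h' - A h' + A h by rewrite -hh subrK.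
    by rewrite [LHS]addrC !addrA addNr add0r addrC.
  move=> /(congr1 (@hnorm R H)) E; have := Ah (h - h'); rewrite -E; have := hnorm_ge0 (h - h'); lra.
have injT h h' : h - T h = h' - T h' -> h = h' := inj T h h' lT Th.
have injT' h h' : h + T h = h' + T h' -> h = h'.
  by move=> hh; apply: (inj _ h h' lT' T'h); rewrite !fctE !opprK.
have exS h : exists s, s - T s = h := neumann lT Th h.
have exS' h : exists s, s + T s = h.
  by have [s sE] := neumann lT' T'h h; exists s; rewrite -sE fctE opprK.
have [S SE] := choice exS; have [S' S'E] := choice exS'.
pose u h := S h + S h - h; pose u' h := S' h + S' h - h.
have uE g : u (g - T g) = g + T g.
  rewrite /u (_ : S _ = g) ?opprB; last by apply: injT; rewrite SE.
  by rewrite [LHS]addrC addrA subrK addrC.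
have u'E g : u' (g + T g) = g - T g.
  rewrite /u' (_ : S' _ = g); last by apply: injT'; rewrite S'E.
  by rewrite opprD addrA addrK.
have uK h : u' (u h) = h by rewrite -(SE h) uE u'E.
have u'K h : u (u' h) = h by rewrite -(S'E h) u'E uE.
have adj h k : dot (u h) k = dot h (u' k).
  rewrite -(SE h) -(S'E k) uE u'E !(dotDl, dotDr, dotNl, dotNr) !skT.
  ring.
have linS : linear S.
  move=> c h k; apply: injT; rewrite SE lT opprD addrACA -scalerN -scalerDr !SE //.
have linS' : linear S'.
  move=> c h k; apply: injT'; rewrite S'E lT addrACA -scalerDr !S'E //.
have iso h : hnorm (u h) = hnorm h.
  apply/eqP; rewrite -(eqrXn2 (ltn0Sn 1)) ?hnorm_ge0//; apply/eqP/complexI.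
  by rewrite !(hnorm_sqr H_hilbert) adj uK.
exists u, u'; split; first split.
- split; last by exists 1 => h; rewrite iso mul1r.
  by move=> c h k; rewrite /u linS opprD !scalerDr scalerN [RHS]addrACA; congr (_ + _); rewrite addrACA.
- split; last by exists 1 => h; rewrite -iso u'K mul1r.
  by move=> c h k; rewrite /u' linS' opprD !scalerDr scalerN [RHS]addrACA; congr (_ + _); rewrite addrACA.
- by apply/funext => h; exact: uK.
- by apply/funext => h; exact: u'K.
- exact: adj.
move=> x lx.
have xSE : x \o T = T \o x <-> forall h, x (S h) = S (x h).
  split=> [xT h|xS].
    apply: injT; rewrite SE -[T (x _)](congr1 (@^~ (S h)) xT) /=.
    by rewrite -(linN _ lx) -(linD _ _ lx) SE.
  apply/funext => h /=; have := xS (h - T h).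
  rewrite (_ : S (h - T h) = h); last by apply: injT; rewrite SE.
  move=> /(congr1 (fun s => s - T s)); rewrite SE (linD _ _ lx) (linN _ lx) => /addrI /oppr_inj ->//.
rewrite xSE; split=> [xu h|xS].
  have := congr1 (@^~ h) xu; rewrite /= /u !(linD _ _ lx) !(linN _ lx) => /addIr.
  exact: double_inj.
by apply/funext => h; rewrite /= /u !(linD _ _ lx) !(linN _ lx) !xS.
Qed.
End Cayley.

(** * Projection onto the commutant of a normal operator *)

Section Projection.
Variables (R : realType) (H : completeNormedModType R[i]).
Variable dot : {dot H for Num.conj}.
Hypothesis H_hilbert : is_hilbert dot.
Variables J J1 : normedSubspace (H -> H).
Hypothesis JJ1 : dual_pair dot J J1.
Let sJ := dp_ideal JJ1.

Lemma J_lin (c : R[i]) x y : J x -> J y -> J (c *: x + y).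
Proof. by move=> Jx Jy; apply: ns_D => //; exact: (sni_scale sJ c Jx).1. Qed.

Record mean_projection (E : (H -> H) -> (H -> H)) (u : H -> H) : Prop := MeanProjection {
  mp_J : forall x, J x -> J (E x);
  mp_norm : forall x, J x -> ns_norm J (E x) <= ns_norm J x + ns_norm J x;
  mp_lin : forall (c : R[i]) x y, J x -> J y -> E (c *: x + y) = c *: E x + E y;
  mp_skew : forall x, J x -> skew_adjoint dot x -> skew_adjoint dot (E x);
  mp_comm : forall x, J x -> E x \o u = u \o E x;
  mp_id : forall x, J x -> x \o u = u \o x -> E x = x;
  mp_preserve : forall x w w', J x -> adjoint dot w w' -> u \o w = w \o u ->
    x \o w = w \o x -> E x \o w = w \o E x }.

(** The algebraic properties are checked on the matrix coefficients
    LIM << u^n x u^-n h, k >>; shift invariance of LIM gives u (E x) = (E x) u. *)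
Lemma mean_projection_exists u u' : unitary_pair dot u u' -> exists E, mean_projection E u.
Proof.
move=> [bu bu' u'u uu' adju].
have [L [Llin Lb Lshift Lcst Lconj]] := exists_complex_banach_limit R.
pose P x y := [/\ J y, ns_norm J y <= ns_norm J x + ns_norm J x &
  forall h k, dot (y h) k = L (fun n => dot (orbit_conj u u' n x h) k)].
have orbJ n x (Jx : J x) := orbit_conj_J H_hilbert JJ1 bu bu' uu' u'u adju n Jx.
pose E x := xget 0 (P x).
have EP x : J x -> P x (E x).
  move=> Jx; apply: (@xgetPex _ 0 (P x)).
  exact: (orbit_mean_exists H_hilbert JJ1 bu bu' uu' u'u adju Llin Lb Jx).
have EE x h k : J x -> dot (E x h) k = L (fun n => dot (orbit_conj u u' n x h) k).
  by move=> /EP[].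
have Eb x h k : J x -> bounded_cseq (fun n => dot (orbit_conj u u' n x h) k).
  move=> Jx; exists (ns_norm J x * hnorm h * hnorm k) => n.
  have [Jn xn] := orbJ n _ Jx.
  apply: le_trans (CauchySchwarz_hnorm H_hilbert _ _) _.
  rewrite ler_wpM2r ?hnorm_ge0//; apply: le_trans (J_hnorm_le H_hilbert sJ _ Jn) _.
  by rewrite ler_wpM2r ?hnorm_ge0.
have uK h : u' (u h) = h by exact: (congr1 (@^~ h) u'u).
have u'K h : u (u' h) = h by exact: (congr1 (@^~ h) uu').
have adju' h k : dot (u' h) k = dot h (u k) by rewrite -{2}(u'K h) adju uK.
have orbS n x h : orbit_conj u u' n.+1 x h = u (orbit_conj u u' n x (u' h)) by [].
have orb_lin n (c : R[i]) x y h :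
    orbit_conj u u' n (c *: x + y) h = c *: orbit_conj u u' n x h + orbit_conj u u' n y h.
  elim: n h => [//|n IH] h.
  by rewrite !orbS IH bu.1.
have orb_skew n x h k : skew_adjoint dot x -> dot (orbit_conj u u' n x h) k = - dot h (orbit_conj u u' n x k).
  move=> sx; elim: n h k => [|n IH] h k; first by rewrite /= sx /= fctE dotNr.
  by rewrite !orbS adju IH adju'.
have orb_comm n x w : x \o w = w \o x -> u \o w = w \o u -> u' \o w = w \o u' ->
    forall h, orbit_conj u u' n x (w h) = w (orbit_conj u u' n x h).
  move=> xw uw u'w; elim: n => [|n IH] h; first exact: (congr1 (@^~ h) xw).
  rewrite !orbS (congr1 (@^~ h) u'w : u' (w h) = w (u' h)) IH.
  exact: (congr1 (@^~ _) uw).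
exists E; split.
- by move=> x /EP[].
- by move=> x /EP[].
- move=> c x y Jx Jy; apply/funext => h; apply: (dot_inj H_hilbert) => k.
  rewrite !fctE dotDl dotZl !EE//; last exact: J_lin.
  rewrite -Llin; [|exact: Eb|exact: Eb]; congr L; apply/funext => n.
  by rewrite orb_lin dotDl dotZl.
- move=> x Jx sx h k; rewrite fctE dotNr EE// [dot h _]dotC EE// -Lconj; last exact: Eb.
  rewrite -[RHS]mulN1r -[RHS]addr0 -(Lcst 0) -Llin; first last.
  - by exists 0 => n; rewrite Normc.normc0.
  - by have [M xM] := Eb x k h Jx; exists M => n; rewrite -dotC -lecR -normcE_C dotC norm_conjC normcE_C lecR.
  congr L; apply/funext => n; rewrite addr0 mulN1r -dotC; exact: orb_skew.
- move=> x Jx; apply/funext => h; apply: (dot_inj H_hilbert) => k /=.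
  rewrite adju !EE// -(Lshift _ (Eb _ _ _ Jx)); congr L; apply/funext => n.
  by rewrite orbS adju uK.
- move=> x Jx xu; apply/funext => h; apply: (dot_inj H_hilbert) => k.
  rewrite EE//.
  have xn n : forall h, orbit_conj u u' n x h = x h.
    elim: n => [//|n IH] h'; rewrite orbS IH.
    by rewrite -[u (x _)](congr1 (@^~ (u' h')) xu) /= u'K.
  by under [X in L X]eq_fun do rewrite xn; exact: Lcst.
- move=> x w w' Jx aw uw xw.
  have u'w : u' \o w = w \o u'.
    apply/funext => h /=.
    by rewrite -{1}(u'K h) -[w (u _)](congr1 (@^~ (u' h)) uw) /= uK.
  apply/funext => h; apply: (dot_inj H_hilbert) => k /=.
  rewrite aw !EE//; congr L; apply/funext => n.
  by rewrite orb_comm// aw.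
Qed.

(** |a' h|^2 = << a a' h, h >> <= M |a' h| |h|. *)
Lemma adjoint_bounded a a' : bounded_op a -> adjoint dot a a' -> bounded_op a'.
Proof.
move=> ba aa'; split.
  move=> c h k; apply: (dot_inj H_hilbert) => f.
  rewrite dotDl dotZl ![dot _ f]dotC -!aa' dotDr dotZr rmorphD rmorphM /=.
  by rewrite conjCK.
have [M M0 aM] := bounded_op_le ba; exists M => h.
have [->|h0] := eqVneq (hnorm (a' h)) 0; first by rewrite mulr_ge0 ?hnorm_ge0.
have hp : 0 < hnorm (a' h) by rewrite lt_def h0 hnorm_ge0.
rewrite -(ler_pM2r hp) -expr2 -lecR (hnorm_sqr H_hilbert) -aa'.
apply: (@le_trans _ _ `|dot (a (a' h)) h|).
  by rewrite ger0_norm// aa' -(hnorm_sqr H_hilbert) ler0c sqr_ge0.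
rewrite normcE_C lecR; apply: le_trans (CauchySchwarz_hnorm H_hilbert _ _) _.
by rewrite mulrAC ler_wpM2r ?hnorm_ge0.
Qed.

Lemma comm_scale (x b : H -> H) (c : R[i]) : linear x -> c != 0 ->
  x \o (c *: b) = (c *: b) \o x <-> x \o b = b \o x.
Proof.
move=> lx c0; split=> xb; apply/funext => h.
  have := congr1 (@^~ h) xb; rewrite /= !fctE (linZ _ _ lx).
  by move=> /(congr1 ( *:%R c^-1)); rewrite !scalerA mulVf// !scale1r.
by rewrite /= !fctE (linZ _ _ lx); congr (_ *: _); exact: (congr1 (@^~ h) xb).
Qed.

Lemma comm_opD (x b c : H -> H) : linear x ->
  x \o b = b \o x -> x \o c = c \o x -> x \o (b + c) = (b + c) \o x.
Proof.
move=> lx xb xc; apply/funext => h; rewrite /= !fctE (linD _ _ lx).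
by rewrite (congr1 (@^~ h) xb : x (b h) = _) (congr1 (@^~ h) xc : x (c h) = _).
Qed.

(** Passing to adjoints turns x a = a x into a' x = x a', because the adjoint of
    x is - x. *)
Lemma skew_comm_adjoint x a a' : adjoint dot a a' -> skew_adjoint dot x ->
  x \o a = a \o x -> x \o a' = a' \o x.
Proof.
move=> aa' sx xa; apply/funext => h; apply: (dot_inj H_hilbert) => k /=.
have adj' f g : dot (a' f) g = dot f (a g) by rewrite dotC -aa' -dotC.
rewrite [LHS]sx fctE dotNr adj' [RHS]adj' sx fctE dotNr.
by congr (- dot _ _); exact/esym/(congr1 (@^~ k) xa).
Qed.

(** T1 and T2 are small multiples of the skew operators a - a' and i (a + a'), so
    their Cayley transforms u and v generate the same commutant as a and a'.
    Averaging over v and then over u stays in the commutant of v because u and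
    v commute. *)
Lemma commutant_projection a : normal_op dot a -> exists E : (H -> H) -> (H -> H),
  [/\ forall x, J x -> J (E x) /\ ns_norm J (E x) <= 4 * ns_norm J x,
      forall (c : R[i]) x y, J x -> J y -> E (c *: x + y) = c *: E x + E y,
      forall x, J x -> skew_adjoint dot x -> skew_adjoint dot (E x),
      forall x, J x -> E x \o a = a \o E x &
      forall x, J x -> skew_adjoint dot x -> x \o a = a \o x -> E x = x].
Proof.
move=> [ba [a' aa' aa'C]]; have ba' := adjoint_bounded ba aa'.
have a'a h k : dot (a' h) k = dot h (a k) by rewrite dotC -aa' -dotC.
have [[M M0 aM] [M' M'0 a'M']] := (bounded_op_le ba, bounded_op_le ba').
pose e : R := (2 * (M + M' + 1))^-1.
have MM : 0 < M + M' + 1 by rewrite ltr_wpDl ?addr_ge0.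
have e0 : 0 < e by rewrite invr_gt0 mulr_gt0.
pose c1 : R[i] := e%:C; pose c2 : R[i] := Complex 0 e.
have c10 : c1 != 0 by rewrite eq_complex /= negb_and gt_eqF.
have c20 : c2 != 0 by rewrite eq_complex /= negb_and (gt_eqF e0) orbT.
have nc1 : Normc.normc c1 = e by rewrite normc_ge0r// ltW.
have nc2 : Normc.normc c2 = e by rewrite /= expr0n add0r sqrtr_sqr ger0_norm// ltW.
pose T1 : H -> H := c1 *: (a + -1 *: a'); pose T2 : H -> H := c2 *: (a + a').
have bT1 : bounded_op T1 by apply/bounded_opZ/bounded_opD => //; exact: bounded_opZ.
have bT2 : bounded_op T2 by apply/bounded_opZ/bounded_opD.
have eM h t : t <= (M + M') * hnorm h -> e * t <= 2^-1 * hnorm h.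
  move=> tM; rewrite /e invfM -mulrA ler_wpM2l ?invr_ge0//.
  rewrite ler_pdivrMl//; apply: le_trans tM _.
  by rewrite ler_wpM2r ?hnorm_ge0// lerDl.
have T1h h : hnorm (T1 h) <= 2^-1 * hnorm h.
  rewrite /T1 fctE hnormZ nc1; apply: eM; rewrite ?fctE scaleN1r mulrDl.
  by apply: le_trans (hnormD _ _) _; rewrite hnormN lerD.
have T2h h : hnorm (T2 h) <= 2^-1 * hnorm h.
  rewrite /T2 fctE hnormZ nc2; apply: eM; rewrite ?fctE mulrDl.
  by apply: le_trans (hnormD _ _) _; rewrite lerD.
have T1s h k : dot (T1 h) k = - dot h (T1 k).
  rewrite /T1 !fctE !scaleN1r dotZl dotZr !(dotDl, dotDr, dotNl, dotNr) aa' a'a.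
  rewrite conj_Creal ?complex_real//; ring.
have T2s h k : dot (T2 h) k = - dot h (T2 k).
  rewrite /T2 !fctE dotZl dotZr !(dotDl, dotDr) aa' a'a.
  have -> : Num.conj c2 = - c2.
    rewrite /c2 -[Num.conj _]/(Complex 0 (- e)).
    by apply/eqP; rewrite eq_complex /= oppr0 !eqxx.
  ring.
have [u [u' [uP uT]]] := cayley_unitary_pair H_hilbert bT1.1 T1h T1s.
have [v [v' [vP vT]]] := cayley_unitary_pair H_hilbert bT2.1 T2h T2s.
have aC b : linear b -> b \o a = a \o b -> b \o a' = a' \o b ->
    b \o T1 = T1 \o b /\ b \o T2 = T2 \o b.
  move=> lb ab a'b; split; apply/comm_scale => //; apply: comm_opD => //.
  by apply/comm_scale => //; rewrite oppr_eq0 oner_eq0.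
have Ca b : linear b -> b \o T1 = T1 \o b -> b \o T2 = T2 \o b -> b \o a = a \o b.
  move=> lb /comm_scale b1 /comm_scale b2.
  have := comm_opD lb (b1 lb c10) (b2 lb c20).
  have -> : a + -1 *: a' + (a + a') = 2 *: a.
    by rewrite scaleN1r addrACA addNr addr0 -mulr2n -scaler_nat.
  by move=> /comm_scale; apply=> //; rewrite pnatr_eq0.
have T21 : T2 \o T1 = T1 \o T2.
  have [||//] := aC T2 bT2.1.
  - by apply/esym/comm_scale; [exact: ba.1|exact: c20|apply: comm_opD; [exact: ba.1|by []|exact: aa'C]].
  - by apply/esym/comm_scale; [exact: ba'.1|exact: c20|apply: comm_opD; [exact: ba'.1|exact/esym/aa'C|by []]].
have uv : u \o v = v \o u.
  apply/vT; first exact: (up_bounded uP).1.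
  by apply/esym; apply: (uT _ bT2.1).2.
have [Eu EuP] := mean_projection_exists uP; have [Ev EvP] := mean_projection_exists vP.
exists (Eu \o Ev); split.
- move=> x Jx; have Jv := mp_J EvP Jx; split; first exact: mp_J EuP _ Jv.
  have := mp_norm EuP Jv; have := mp_norm EvP Jx; rewrite /=; lra.
- move=> c x y Jx Jy /=; rewrite (mp_lin EvP)// (mp_lin EuP)//; exact: mp_J EvP _ _.
- move=> x Jx sx; apply: (mp_skew EuP); [exact: mp_J EvP _ _|exact: mp_skew EvP _ _ _].
- move=> x Jx; have Jv := mp_J EvP Jx; have Ju := mp_J EuP Jv.
  have lu := (sni_bounded sJ Ju).1.
  apply: Ca => //; first by apply/uT => //; exact: mp_comm EuP _ Jv.
  apply/vT => //; apply: (mp_preserve EuP Jv (up_adj vP) uv).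
  exact: mp_comm EvP _ Jx.
- move=> x Jx sx xa; have lx := (sni_bounded sJ Jx).1.
  have [x1 x2] := aC _ lx xa (skew_comm_adjoint aa' sx xa).
  rewrite /= (mp_id EvP)//; last exact/vT.
  by rewrite (mp_id EuP)//; exact/uT.
Qed.

End Projection.

(** * Submanifolds and velocities *)

Section Submanifolds.
Variable R : realType.

Lemma smooth_map_sub (E F : normedModType R) (A B : set E) (f : E -> F) :
  B `<=` A -> smooth_map A f -> smooth_map B f.
Proof.
move=> BA sf p /BA /sf [U [g [oU Up sg fg]]]; exists U, g; split=> // x /BA; exact: fg.
Qed.

Lemma submanifold_manifold (E : normedModType R) (M g N L : set E) :
  submanifold M g N L -> closed_subspace L -> L `<=` g -> manifold N L.
Proof.
move=> [NM ch] cL Lg; split=> // p Np.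
have [U [Q [phi [psi [Up [[oU oQ] sphi spsi c1 c2] NL]]]]] := ch p Np.
exists U, Q, phi, psi; split=> //; split=> //.
- by apply: smooth_map_sub sphi => x [Nx Ux]; split=> //; exact: NM.
- by apply: smooth_map_sub spsi => x [Lx Ox]; split=> //; exact: Lg.
- move=> x [Nx Ux]; have MUx : (M `&` U) x by split=> //; exact: NM.
  by have [[_ Ox] ->] := c1 x MUx; split=> //; split=> //; exact/NL.
- move=> y [Ly Oy]; have gOy : (g `&` Q) y by split=> //; exact: Lg.
  have [MUy yE] := c2 y gOy; split=> //; split; last exact: MUy.2.
  by apply/(NL _ MUy); rewrite yE.
Qed.

Lemma smooth_map_derive (E : normedModType R) (c : R -> E) (t : R) :
  smooth_map [set: R^o] c -> differentiable (c : R^o -> E) t.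
Proof.
move=> /(_ t I)[U [g [oU Ut sg cg]]].
have dg := smooth_differentiable sg Ut.
suff [dc _] : is_diff (t : R^o) c ('d (g : R^o -> E) t) by [].
apply: is_diff_near dg; apply: filterS (near_open oU Ut) => s Us.
by rewrite cg.
Qed.

(** The difference quotients of [c] at 0 lie in the closed subspace [L]. *)
Lemma velocity_in_closed (E : normedModType R) (L : set E) (c : R^o -> E) :
  closed_subspace L -> differentiable c 0 -> c 0 = 0 ->
  (\forall t \near (0 : R^o), L (c t)) -> L ('d c 0 1).
Proof.
move=> [cL L0 Llin] dc c0 Lc.
rewrite -deriveE//.
have := @diff_derivable _ _ _ c 0 1 dc; rewrite /derivable => dcv.
apply: (closed_cvg L cL _ _ dcv).
apply: nbhs_dnbhs; apply: filterS Lc => t Lct.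
rewrite /= c0 subr0 addr0 [_%:A]mulr1 -[_ *: c t]addr0.
exact: Llin.
Qed.

(** In this form, a quantity that is Lipschitz in x and vanishes on [A] is seen
    to vanish on the closure of [A]. *)
Lemma closure_norm (E : normedModType R) (A : set E) (x : E) (r C : R) :
  closure A x -> (forall y, A y -> r <= C * `|x - y|) -> r <= 0.
Proof.
move=> clA rC; apply/ler_addgt0Pl => e e0; rewrite addr0.
have C0 : 0 < `|C| + 1 by rewrite ltr_wpDl.
have [y [Ay xy]] := clA (ball x (e / (`|C| + 1))) (nbhsx_ballx _ _ (divr_gt0 e0 C0)).
apply: le_trans (rC y Ay) _; move: xy; rewrite -ball_normE /= ltr_pdivlMr// => xy.
apply: (le_trans _ (ltW xy)); rewrite mulrC ler_wpM2l//.
by apply: le_trans (ler_norm _) _; rewrite lerDl.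
Qed.

End Submanifolds.

(** * The Banach algebra structure of an ideal *)

Section IdealAlgebra.
Variables (R : realType) (H : completeNormedModType R[i]).
Variable dot : {dot H for Num.conj}.
Hypothesis H_hilbert : is_hilbert dot.
Variable J : normedSubspace (H -> H).
Hypothesis sJ : symm_normed_ideal dot J.
Implicit Types x y z : elt J.

Let lJ x : linear (elt_val x). Proof. exact: (sni_bounded sJ (eltP x)).1. Qed.

Lemma J_comp (x y : H -> H) : J x -> J y ->
  J (x \o y) /\ ns_norm J (x \o y) <= ns_norm J x * ns_norm J y.
Proof.
move=> Jx Jy; have [Jxy xy] := sni_ideal sJ (sni_bounded sJ Jx) Jy (bounded_op_id H).
split=> //; apply: le_trans xy _.
have x1 : opnorm x <= ns_norm J x.
  by apply: opnorm_le; [exact: J_ge0 Jx|move=> h; exact: (J_hnorm_le H_hilbert sJ h Jx)].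
have i1 : opnorm (id : H -> H) <= 1 by apply: opnorm_le => // h; rewrite mul1r.
have i0 : 0 <= opnorm (id : H -> H).
  rewrite -(hnorm0 H); apply: ub_le_sup; first by exists 1 => _ [h h1 <-].
  by exists 0 => //=; rewrite hnorm0.
apply: (@le_trans _ _ (ns_norm J x * ns_norm J y * opnorm (id : H -> H))).
  by rewrite ler_wpM2r// ler_wpM2r ?(J_ge0 Jy).
by rewrite -[leRHS]mulr1 ler_wpM2l// mulr_ge0 ?(J_ge0 Jx) ?(J_ge0 Jy).
Qed.

Definition Jmul x y : elt J := Elt (J_comp (eltP x) (eltP y)).1.

Lemma JmulDl x x' y : Jmul (x + x') y = Jmul x y + Jmul x' y.
Proof. exact: elt_inj. Qed.
Lemma JmulDr x y y' : Jmul x (y + y') = Jmul x y + Jmul x y'.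
Proof. by apply: elt_inj; apply/funext => h; exact: linD. Qed.
Lemma JmulZl (r : R) x y : Jmul (r *: x) y = r *: Jmul x y.
Proof. exact: elt_inj. Qed.
Lemma JmulZr (r : R) x y : Jmul x (r *: y) = r *: Jmul x y.
Proof. by apply: elt_inj; apply/funext => h; exact: linZ. Qed.
Lemma JmulA x y z : Jmul x (Jmul y z) = Jmul (Jmul x y) z.
Proof. exact: elt_inj. Qed.
Lemma Jmul_le x y : `|Jmul x y| <= `|x| * `|y|.
Proof. exact: (J_comp (eltP x) (eltP y)).2. Qed.

Let JC := sni_banach sJ.

Definition Jcirc := circ Jmul.
Definition Jregular := qregular Jmul.
Definition Jinv := qinv Jmul.
Local Notation one_plus x := (id + elt_val x).

Lemma one_plusE x h : one_plus x h = h + elt_val x h. Proof. by []. Qed.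

Lemma one_plusD x h k : one_plus x (h + k) = one_plus x h + one_plus x k.
Proof. by rewrite !one_plusE (linD _ _ (lJ x)) addrACA. Qed.

Lemma one_plus_circ x y : one_plus (Jcirc x y) = one_plus x \o one_plus y.
Proof.
apply/funext => h; rewrite /= !fctE /= (linD _ _ (lJ x)).
by rewrite [elt_val x h + _]addrC !addrA.
Qed.

Lemma one_plus_inj x y : one_plus x = one_plus y -> x = y.
Proof. by move=> /addrI xy; exact: elt_inj. Qed.

Lemma one_plus0 : one_plus (0 : elt J) = id. Proof. exact: addr0. Qed.

Lemma Jinv_l x h : Jregular x -> one_plus (Jinv x) (one_plus x h) = h.
Proof.
move=> /(qinvP)[_ q]; have := congr1 (fun z : elt J => one_plus z h) q.
by rewrite -/(Jcirc _ _) one_plus_circ one_plus0.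
Qed.

Lemma Jinv_r x h : Jregular x -> one_plus x (one_plus (Jinv x) h) = h.
Proof.
move=> /(qinvP)[q _]; have := congr1 (fun z : elt J => one_plus z h) q.
by rewrite -/(Jcirc _ _) one_plus_circ one_plus0.
Qed.

(** The inverse of a unitary of 1 + J lies in 1 + J: u^-1 - 1 = - u^-1 (u - 1). *)
Lemma JregularP x (u' : H -> H) : one_plus x \o u' = id -> u' \o one_plus x = id -> bounded_op u' ->
  Jregular x /\ one_plus (Jinv x) = u'.
Proof.
move=> xu' u'x bu'.
have Jw : J (u' - id).
  have := (sni_ideal sJ bu' (eltP (- x)) (bounded_op_id H)).1.
  congr (ns_carrier J); apply/funext => h; rewrite /= !fctE (linN _ bu'.1).
  have E : u' h + u' (elt_val x h) = h by rewrite -(linD _ _ bu'.1); exact: (congr1 (@^~ h) u'x).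
  by rewrite -[X in _ = _ - X]E opprD addrA subrr add0r.
have wE : one_plus (Elt Jw) = u' by rewrite /= addrC subrK.
have pair : qinv_pair Jmul x (Elt Jw).
  by split; apply: one_plus_inj; rewrite -/(Jcirc _ _) one_plus_circ wE one_plus0.
have Wx : Jregular x by exists (Elt Jw).
by split=> //; rewrite /Jinv (qinv_eq JmulDl JmulDr JmulA pair).
Qed.

(** |(1 + x) h|^2 = |h|^2 + |x h|^2, as << x h, h >> + << h, x h >> = 0. *)
Lemma skew_expand x h : skew_adjoint dot (elt_val x) -> hnorm h <= hnorm (one_plus x h).
Proof.
move=> sx; rewrite -(ler_pXn2r (ltn0Sn 1)) ?nnegrE ?hnorm_ge0// -lecR !(hnorm_sqr H_hilbert).
have e1 : dot (elt_val x h) h = - dot h (elt_val x h) by rewrite sx fctE dotNr.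
have -> : dot (one_plus x h) (one_plus x h) = dot h h + dot (elt_val x h) (elt_val x h).
  by rewrite one_plusE !(dotDl, dotDr) e1; ring.
by rewrite lerDl -(hnorm_sqr H_hilbert) ler0c sqr_ge0.
Qed.

(** Invertibility of 1 + t x is continued from t = 0 to t = 1 in steps 1 / (N + 1)
    with N + 1 > |x|.  The step is uniform: (1 + t x)^-1 is a contraction by
    [skew_expand], so Neumann's series for 1 + (1 + t x)^-1 (x / (N + 1))
    converges in the norm of [J]. *)
Lemma skew_regular x : skew_adjoint dot (elt_val x) -> Jregular x.
Proof.
move=> sx; have [N hN] : exists N : nat, `|x| < N.+1%:R.
  by exists (Num.bound `|x|); apply: lt_le_trans (archi_boundP (normr_ge0 _)) _; rewrite ler_nat.
pose y := N.+1%:R^-1 *: x.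
have y1 : `|y| < 1.
  by rewrite normrZ ger0_norm ?invr_ge0// ltr_pdivrMl// mulr1.
suff Wk k : Jregular (k%:R *: y).
  by have := Wk N.+1; rewrite /y scalerA mulfV ?scale1r// pnatr_eq0.
elim: k => [|k IH].
  rewrite scale0r; apply: (qregular_small JmulDl JmulDr JmulZl JmulZr JmulA Jmul_le JC).
  by rewrite normr0.
have sk : skew_adjoint dot (elt_val (k%:R *: y)).
  by do 2 apply: skew_adjointZ.
pose z := y + Jmul (Jinv (k%:R *: y)) y.
have -> : k.+1%:R *: y = Jcirc (k%:R *: y) z.
  apply: one_plus_inj; rewrite one_plus_circ; apply/funext => h.
  rewrite -[RHS]/(one_plus (k%:R *: y) (h + one_plus (Jinv (k%:R *: y)) (elt_val y h))).
  rewrite one_plusD Jinv_r// -natr1 scalerDl scale1r !one_plusE.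
  by rewrite -[elt_val (_ + _) h]/(elt_val (k%:R *: y) h + elt_val y h) addrA.
apply: (qregular_circ JmulDl JmulDr JmulA) => //.
apply: (qregular_small JmulDl JmulDr JmulZl JmulZr JmulA Jmul_le JC).
apply: le_lt_trans y1.
have bi : bounded_op (one_plus (Jinv (k%:R *: y))).
  by apply: bounded_opD; [exact: bounded_op_id|exact: (sni_bounded sJ (eltP _))].
have [||_] := J_conj sJ bi (eltP y) (bounded_op_id H) => //.
  by move=> h; apply: le_trans (skew_expand _ sk) _; rewrite Jinv_r.
Qed.

Lemma open_Jregular : open Jregular.
Proof. exact: (open_qregular JmulDl JmulDr JmulZl JmulZr JmulA Jmul_le JC). Qed.

Lemma smooth_Jinv : smooth_on Jregular Jinv.
Proof. exact: (smooth_qinv JmulDl JmulDr JmulZl JmulZr JmulA Jmul_le JC). Qed.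

Lemma diff_Jinv0 : differentiable Jinv 0 /\ forall v, 'd Jinv 0 v = - v.
Proof.
have p0 : qinv_pair Jmul 0 0 by split; rewrite (circ0l JmulDl).
have W0 : Jregular 0 by exists 0.
have [dJ dJE] := is_diff_qinv JmulDl JmulDr JmulZl JmulZr JmulA Jmul_le JC W0.
split=> // v; rewrite dJE (qinv_eq JmulDl JmulDr JmulA p0) /qinv_diff /=.
have m0l y : Jmul 0 y = 0 by exact: elt_inj.
have m0r y : Jmul y 0 = 0.
  by apply: elt_inj; apply/funext => h; exact: lin0 (sni_bounded sJ (eltP y)).1.
by rewrite m0r m0l !addr0.
Qed.

Lemma smooth_Jcirc (D : normedModType R) (U : set D) (f g : D -> elt J) : open U ->
  smooth_on U f -> smooth_on U g -> smooth_on U (fun t => Jcirc (f t) (g t)).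
Proof.
move=> oU sf sg.
have mC x y : `|Jmul x y| <= 1 * `|x| * `|y| by rewrite mul1r; exact: Jmul_le.
apply: smoothD => //; first exact: smoothD.
exact: (smooth_bilinear JmulDl JmulDr JmulZl JmulZr mC).
Qed.

Lemma JcircA x y z : Jcirc x (Jcirc y z) = Jcirc (Jcirc x y) z.
Proof. exact: (circA JmulDl JmulDr JmulA). Qed.
Lemma Jcirc0l x : Jcirc 0 x = x. Proof. exact: (circ0l JmulDl). Qed.
Lemma JcircVl x : Jregular x -> Jcirc (Jinv x) x = 0.
Proof. by move=> /qinvP[]. Qed.
Lemma JcircVr x : Jregular x -> Jcirc x (Jinv x) = 0.
Proof. by move=> /qinvP[]. Qed.
Lemma JinvK x : Jregular x -> Jinv (Jinv x) = x.
Proof. exact: (qinvK JmulDl JmulDr JmulA). Qed.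
Lemma Jregular_inv x : Jregular x -> Jregular (Jinv x).
Proof. exact: qregular_qinv. Qed.
Lemma Jregular_circ x y : Jregular x -> Jregular y -> Jregular (Jcirc x y).
Proof. exact: (qregular_circ JmulDl JmulDr JmulA). Qed.

(** * Cayley charts of the unitary group *)

Lemma in_chart_UJ x : @in_chart _ _ J (UJ dot J) x <-> unitary dot (one_plus x).
Proof.
split=> [[_]//|ux]; split=> //.
by rewrite [id + _]addrC addrK; exact: eltP.
Qed.

Lemma unitary_isometry x h k : unitary dot (one_plus x) ->
  dot (one_plus x h) (one_plus x k) = dot h k.
Proof. by move=> [_ [u' [adj _ u'u]]]; rewrite adj -[u' _]/((u' \o one_plus x) k) u'u. Qed.

Lemma unitary_regular x : unitary dot (one_plus x) ->
  Jregular x /\ adjoint dot (one_plus x) (one_plus (Jinv x)).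
Proof.
move=> [bu [u' [adj uu' u'u]]].
have bu' := adjoint_bounded H_hilbert bu adj.
by have [Wx ->] := JregularP uu' u'u bu'.
Qed.

Lemma isometry_unitary x : Jregular x ->
  (forall h k, dot (one_plus x h) (one_plus x k) = dot h k) -> unitary dot (one_plus x).
Proof.
move=> Wx iso; split.
  by apply: bounded_opD; [exact: bounded_op_id|exact: (sni_bounded sJ (eltP x))].
exists (one_plus (Jinv x)); split.
- by move=> h k; rewrite -{1}(Jinv_r k Wx) iso.
- by apply/funext => h; exact: Jinv_r.
- by apply/funext => h; exact: Jinv_l.
Qed.

Lemma unitary_circ x y : unitary dot (one_plus x) -> unitary dot (one_plus y) ->
  unitary dot (one_plus (Jcirc x y)).
Proof.
move=> ux uy; apply: isometry_unitary.
  by apply: Jregular_circ; [exact: (unitary_regular ux).1|exact: (unitary_regular uy).1].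
by move=> h k; rewrite !one_plus_circ /= !unitary_isometry.
Qed.

Lemma unitary_inv x : unitary dot (one_plus x) -> unitary dot (one_plus (Jinv x)).
Proof.
move=> ux; have [Wx _] := unitary_regular ux.
apply: isometry_unitary => [|h k]; first exact: Jregular_inv.
by rewrite -(unitary_isometry _ _ ux) !Jinv_r.
Qed.

(** Here z = w / 2 and - qinv z = z (1 + z)^-1.  On the vectors (1 + z) h and
    (1 + z) k, the defect of skewness is
    << z h, (1 + z) k >> + << (1 + z) h, z k >>, which is half of
    << (1 + w) h, (1 + w) k >> - << h, k >>. *)
Lemma cayley_skew w : Jregular (2^-1 *: w) -> unitary dot (one_plus w) ->
  skew_adjoint dot (elt_val (- Jinv (2^-1 *: w))).
Proof.
move=> Wz uw; set z := 2^-1 *: w in Wz *; set x := - Jinv z.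
have xz h : elt_val x (one_plus z h) = elt_val z h.
  have := Jinv_l h Wz; set g := one_plus z h => /(congr1 (fun k => k - g)).
  rewrite one_plusE addrAC subrr add0r => E.
  by rewrite -[LHS]/(- elt_val (Jinv z) g) E /g one_plusE opprB addrAC subrr add0r.
have wz h : elt_val w h = elt_val z h + elt_val z h.
  rewrite -[elt_val z h + _]/(elt_val (z + z) h); congr (elt_val _ h).
  have h2 : 2^-1 + 2^-1 = 1 :> R by lra.
  by rewrite /z -scalerDl h2 scale1r.
suff sk h k : dot (elt_val x h) k + dot h (elt_val x k) = 0.
  move=> h k; rewrite fctE dotNr; apply/eqP; rewrite -addr_eq0; exact/eqP/sk.
rewrite -(Jinv_r h Wz) -(Jinv_r k Wz) !xz.
move: (one_plus (Jinv z) h) (one_plus (Jinv z) k) => {}h {}k.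
have := unitary_isometry h k uw.
rewrite !one_plusE !wz !(dotDl, dotDr).
set A := dot h k; set B := dot (elt_val z h) k; set C := dot h (elt_val z k).
set D := dot (elt_val z h) (elt_val z k) => E.
apply: double_inj; rewrite addr0.
have -> : B + D + (C + D) + (B + D + (C + D)) = A + (C + C) + (B + B + (D + D + (D + D))) - A by ring.
apply/eqP; rewrite subr_eq0 -[X in _ == X]E; apply/eqP; ring.
Qed.

(** 1 + 2 qinv (- x) = (1 + x) (1 - x)^-1, and 1 + x and 1 - x have the same
    square norms on every vector when x is skew. *)
Lemma cayley_unitary x : skew_adjoint dot (elt_val x) ->
  Jregular (- x) /\ unitary dot (one_plus (2%:R *: Jinv (- x))).
Proof.
move=> sx.
have sNx : skew_adjoint dot (elt_val (- x)).
  by rewrite -scaleN1r; exact: skew_adjointZ.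
have Wx := skew_regular sx; have WNx := skew_regular sNx.
split=> //; set s := Jinv (- x).
have wE : 2%:R *: s = Jcirc x s.
  have := JcircVr WNx; rewrite -/s => E.
  rewrite -[2%:R]/(1 + 1) scalerDl scale1r -[RHS]addr0 -E.
  rewrite /Jcirc /circ.
  have -> : Jmul (- x) s = - Jmul x s by exact: elt_inj.
  by rewrite !addrA [RHS](ACl (2*5*1*4*3*6)) /= !addrK.
apply: isometry_unitary; first by rewrite wE; apply: Jregular_circ => //; exact: Jregular_inv.
move=> h k; rewrite wE !one_plus_circ /=.
rewrite -{2}(Jinv_r h WNx) -{2}(Jinv_r k WNx) -/s.
move: (one_plus s h) (one_plus s k) => {}h {}k.
have := sx h k; rewrite !one_plusE /= !fctE dotNr => E.
by rewrite !(dotDl, dotDr, dotNl, dotNr) E; ring.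
Qed.

(** If 1 + w = (1 + q) (1 + y), this is w (2 + w)^-1: the Cayley transform of the
    left translate of 1 + y by 1 + q. *)
Definition cayley_map q y := - Jinv (2^-1 *: Jcirc q y).
(** 1 + cayley_inv p x = (1 + p) (1 + x) (1 - x)^-1. *)
Definition cayley_inv p x := Jcirc p (2%:R *: Jinv (- x)).

Lemma cayley_chart p : @in_chart _ _ J (UJ dot J) p ->
  let q := Jinv p in
  chart (@in_chart _ _ J (UJ dot J)) (@in_ideal _ _ J (uJ dot J))
    [set y | Jregular (2^-1 *: Jcirc q y)] [set x | Jregular (- x)]
    (cayley_map q) (cayley_inv p).
Proof.
move=> /in_chart_UJ up q; have [Wp _] := unitary_regular up.
have uq := unitary_inv up.
have oT := @openT (elt J).
have sl : smooth_on setT (fun y => 2^-1 *: Jcirc q y).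
  apply: smoothZ => //; apply: smooth_Jcirc => //; [exact: smooth_cst|exact: smooth_id].
have sN : smooth_on setT (fun x : elt J => - x) by apply: smoothN => //; exact: smooth_id.
have oU := open_smooth_preimage sl open_Jregular.
have oO := open_smooth_preimage sN open_Jregular.
have s1 : smooth_on ((fun y => 2^-1 *: Jcirc q y) @^-1` Jregular) (cayley_map q).
  by apply: smoothN => //; exact: smooth_comp_preimage sl open_Jregular smooth_Jinv.
have s2 : smooth_on ((fun x => - x) @^-1` Jregular) (cayley_inv p).
  apply: smooth_Jcirc => //; first exact: smooth_cst.
  apply: smoothZ => //.
  exact: smooth_comp_preimage sN open_Jregular smooth_Jinv.
split.
- by split.
- by apply: (smooth_map_on oU _ s1) => x [].
- by apply: (smooth_map_on oO _ s2) => x [].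
- move=> y [/in_chart_UJ uy /= Wy]; split; first split.
  + split; first exact: eltP.
    apply: cayley_skew => //; exact: unitary_circ.
  + by rewrite /= /cayley_map opprK; exact: Jregular_inv.
  + rewrite /cayley_inv /cayley_map opprK JinvK// scalerA mulfV ?pnatr_eq0// scale1r.
    by rewrite JcircA JcircVr// Jcirc0l.
- move=> x [[_ sx] /= WNx]; have [_ ux] := cayley_unitary sx.
  have lE : 2^-1 *: Jcirc q (cayley_inv p x) = Jinv (- x).
    rewrite /cayley_inv JcircA JcircVl// Jcirc0l scalerA mulVf ?pnatr_eq0// scale1r//.
  split; first split.
  + by apply/in_chart_UJ; apply: unitary_circ.
  + by rewrite /= lE; exact: Jregular_inv.
  + by rewrite /cayley_map lE JinvK// opprK.
Qed.

Section Commutant.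
Variable a : H -> H.
Hypothesis la : linear a.
Definition comm x := elt_val x \o a = a \o elt_val x.

Lemma commP x : comm x <-> one_plus x \o a = a \o one_plus x.
Proof.
split=> xa; apply/funext => h; have := congr1 (@^~ h) xa; rewrite /= !fctE (linD _ _ la).
  by move=> ->.
by move=> /addrI.
Qed.

Lemma comm_circ x y : comm x -> comm y -> comm (Jcirc x y).
Proof.
move=> /commP xa /commP ya; apply/commP; rewrite one_plus_circ.
by rewrite -compA ya compA xa -compA.
Qed.

Lemma comm_eltZ (r : R) x : comm x -> comm (r *: x).
Proof.
move=> xa; apply/funext => h; have := congr1 (@^~ h) xa; rewrite /= !fctE (linZ _ _ la).
by move=> ->.
Qed.

Lemma comm_inv x : Jregular x -> comm x -> comm (Jinv x).
Proof.
move=> Wx /commP xa; apply/commP/funext => h /=.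
have := congr1 (@^~ (one_plus (Jinv x) h)) xa; rewrite /= (Jinv_r _ Wx) => <-.
by rewrite Jinv_l.
Qed.

Lemma comm_cayley_map q y : Jregular (2^-1 *: Jcirc q y) -> comm q -> comm y ->
  comm (cayley_map q y).
Proof.
move=> W qa ya; rewrite /cayley_map -scaleN1r; apply/comm_eltZ/comm_inv => //.
exact/comm_eltZ/comm_circ.
Qed.

Lemma comm_cayley_inv p x : Jregular (- x) -> comm p -> comm x -> comm (cayley_inv p x).
Proof.
move=> W pa xa; apply: comm_circ => //; apply/comm_eltZ/comm_inv => //.
by rewrite -scaleN1r; exact: comm_eltZ.
Qed.

End Commutant.

(** * The stabilizer as a Banach-Lie group *)

Section Stabilizer.
Variable a : H -> H.
Hypothesis ba : bounded_op a.

Let la : linear a := ba.1.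
Let M := @in_chart _ _ J (UJ dot J).
Let g := @in_ideal _ _ J (uJ dot J).
Let N := @in_chart _ _ J (UJ_stab dot J a).
Let L := @in_ideal _ _ J (LUJ_stab dot J a).

Lemma in_ideal_uJ x : g x <-> skew_adjoint dot (elt_val x).
Proof. by split=> [[]//|sx]; split=> //; exact: eltP. Qed.

Lemma in_ideal_LUJ x : L x <-> g x /\ comm a x.
Proof. by []. Qed.

Lemma UJ_stab_comm u : UJ_stab dot J a u <-> UJ dot J u /\ u \o a = a \o u.
Proof.
split=> -[Uu]; have [_ [bu [v [adj uv vu]]]] := Uu.
  move=> [u' adj' E]; split=> //; rewrite -[in RHS]E.
  have -> : u' = v.
    apply/funext => k; apply: (dot_inj H_hilbert) => h.
    by rewrite dotC -adj' adj -dotC.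
  by rewrite -[RHS]/(u \o a \o (v \o u)) vu.
by move=> ua; split=> //; exists v => //; rewrite ua -compA uv.
Qed.

Lemma in_chart_stab x : N x <-> M x /\ comm a x.
Proof.
rewrite /N /in_chart /= UJ_stab_comm; split=> -[Mx xa]; split=> //; exact/(commP la).
Qed.

Lemma comm0 : comm a (0 : elt J).
Proof. by apply/funext => h; rewrite /comm /= (lin0 la). Qed.

Lemma closed_uJ : closed_subspace g.
Proof.
split.
- move=> x clx; apply/in_ideal_uJ => h k; rewrite fctE dotNr; apply/eqP; rewrite -addr_eq0; apply/eqP.
  apply: Normc.eq0_normc; apply/eqP; rewrite eq_le normc_nonneg andbT.
  apply: (@closure_norm _ _ g x _ (hnorm h * hnorm k + hnorm h * hnorm k) clx) => y /in_ideal_uJ sy.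
  have -> : dot (elt_val x h) k + dot h (elt_val x k) =
      dot (elt_val (x - y) h) k + dot h (elt_val (x - y) k).
    rewrite /= !fctE !(dotDl, dotDr, dotNl, dotNr) sy fctE dotNr; ring.
  apply: le_trans (le_normcD _ _) _; rewrite mulrDl.
  have xy f : hnorm (elt_val (x - y) f) <= `|x - y| * hnorm f.
    exact: (J_hnorm_le H_hilbert sJ f (eltP (x - y))).
  apply: lerD; apply: le_trans (CauchySchwarz_hnorm H_hilbert _ _) _.
    by rewrite mulrAC [hnorm h * _]mulrC ler_wpM2r ?hnorm_ge0.
  by rewrite -mulrA [hnorm k * _]mulrC ler_wpM2l ?hnorm_ge0.
- by apply/in_ideal_uJ; exact: skew_adjoint0.
- move=> r x y /in_ideal_uJ sx /in_ideal_uJ sy; apply/in_ideal_uJ.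
  by apply: skew_adjointD => //; exact: skew_adjointZ.
Qed.

Lemma closed_LUJ : closed_subspace L.
Proof.
have [cg g0 glin] := closed_uJ; split.
- move=> x clx; apply/in_ideal_LUJ; split.
    by apply: cg; apply: closure_subset clx => y [].
  apply/funext => h; apply/subr0_eq/hnorm_eq0; apply/eqP; rewrite eq_le hnorm_ge0 andbT.
  have [A A0 aA] := bounded_op_le ba.
  apply: (@closure_norm _ _ L x _ (hnorm (a h) + A * hnorm h) clx) => y [_ ya].
  have -> : (elt_val x \o a) h - (a \o elt_val x) h =
     elt_val (x - y) (a h) - a (elt_val (x - y) h).
    by rewrite /= !fctE (linD _ _ la) (linN _ la) (congr1 (@^~ h) ya : elt_val y (a h) = _)
      opprB addrA subrK.
  have xy f : hnorm (elt_val (x - y) f) <= `|x - y| * hnorm f.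
    exact: (J_hnorm_le H_hilbert sJ f (eltP (x - y))).
  apply: le_trans (hnormD _ _) _; rewrite hnormN mulrDl; apply: lerD.
    by rewrite mulrC.
  apply: le_trans (aA _) _; rewrite -mulrA ler_wpM2l//.
  by rewrite mulrC.
- by split=> //; exact: comm0.
- move=> r x y [gx xa] [gy ya]; split; first exact: glin.
  apply/funext => h; have /(congr1 (@^~ h)) := comm_eltZ la r xa; rewrite /= !fctE => ->.
  by rewrite (linD _ _ la); congr (_ + _); exact: (congr1 (@^~ h) ya).
Qed.

(** Left translation by p and the Cayley transform are built from products and
    inverses, so they preserve commutation with [a] in both directions. *)
Lemma stab_submanifold : submanifold M g N L.
Proof.
split=> [x /in_chart_stab[]//|p /in_chart_stab[Mp pa]].
have ch := cayley_chart Mp; have [Wp _] := unitary_regular ((in_chart_UJ _).1 Mp).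
set q := Jinv p in ch.
have qa : comm a q := comm_inv la Wp pa.
exists [set y | Jregular (2^-1 *: Jcirc q y)], [set x | Jregular (- x)].
exists (cayley_map q), (cayley_inv p); split=> //.
  rewrite /= JcircVl// scaler0.
  by have := skew_regular (skew_adjoint0 dot : skew_adjoint dot (elt_val (0 : elt J))).
case: ch => _ _ _ c1 _ y MUy; have [[gy Oy] yE] := c1 y MUy.
split=> [/in_chart_stab[My ya]|[_ ya]].
  by split; [exact: gy|exact: comm_cayley_map MUy.2 qa ya].
by apply/in_chart_stab; split; [exact: MUy.1|rewrite -yE; exact: comm_cayley_inv].
Qed.

Lemma Jinv0 : Jinv 0 = 0.
Proof.
apply: (qinv_eq (JmulDl) (JmulDr) (JmulA)).
by split; exact: (circ0l (JmulDl)).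
Qed.

(** The Cayley map at the identity, z |-> - qinv (z / 2), has differential 1/2 at
    0 and takes the curve, for small times, into the closed subspace [L]. *)
Lemma stab_tangent_sub : tangent_space N 0 `<=` L.
Proof.
move=> v [c [sc Nc c0 cv]].
have dc := smooth_map_derive 0 sc.
pose z (t : R^o) : elt J := 2^-1 *: c t.
have dz : is_diff (0 : R^o) z (2^-1 *: ('d (c : R^o -> elt J) 0 : R^o -> elt J)).
  have dcc : is_diff (0 : R^o) (c : R^o -> elt J) ('d (c : R^o -> elt J) 0) by apply: DiffDef dc _.
  have := is_diffZ 2^-1 dcc; exact.
have z0 : z 0 = 0 by rewrite /z c0 scaler0.
have W0 : Jregular 0 by exact: (skew_regular (skew_adjoint0 dot : skew_adjoint dot (elt_val (0 : elt J)))).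
have nW : \forall t \near (0 : R^o), Jregular (z t).
  have [dz0 _] := dz; have := differentiable_continuous dz0.
  by apply; rewrite z0; apply: near_open W0; exact: open_Jregular.
have dJ : is_diff (z 0) Jinv (fun w => - w).
  rewrite z0; have [d0 d0E] := diff_Jinv0.
  by apply: DiffDef => //; apply/funext => w; rewrite d0E.
have dk := is_diffN (is_diff_comp dz dJ).
set k : R^o -> elt J := - (Jinv \o z) in dk.
have [dk0 dkE] := dk.
have Lk : L ('d k 0 1).
  apply: (velocity_in_closed closed_LUJ dk0).
    by rewrite /k fctE /= z0 Jinv0 oppr0.
  apply: filterS nW => t Wt.
  have /in_chart_stab[/in_chart_UJ ut at_] := Nc t.
  split.
    by apply/in_ideal_uJ; exact: cayley_skew.
  rewrite -[elt_val (k t)]/(elt_val (- Jinv (z t))) -scaleN1r.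
  by apply: comm_eltZ => //; apply: comm_inv => //; exact: comm_eltZ.
have [_ L0 Llin] := closed_LUJ.
have -> : v = 2%:R *: ('d k 0 1 : elt J) + 0.
  rewrite dkE addr0 !fctE /= opprK scalerA mulfV ?pnatr_eq0// scale1r -cv.
  by rewrite derive1E'.
exact: Llin.
Qed.

(** The curve (1 + t v / 2) (1 - t v / 2)^-1 is defined for all t, because skew
    elements are quasi-regular, and has velocity v at 0. *)
Lemma stab_tangent_sup : L `<=` tangent_space N 0.
Proof.
move=> v Lv; have [cL L0 Llin] := closed_LUJ.
have Lt (t : R) : L (t *: (2^-1 *: v)) by rewrite -[X in L X]addr0 scalerA; exact: Llin.
pose v2 := 2^-1 *: v.
pose f (t : R^o) : elt J := - (t *: v2).
have cay t := cayley_unitary ((in_ideal_uJ _).1 (Lt t).1).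
have lin : linear (fun t : R^o => t *: v2).
  by move=> r s t; rewrite scalerDl -[(r *: s) *: _]scalerA.
pose l : {linear R^o -> elt J} := HB.pack (fun t : R^o => t *: v2) (GRing.isLinear.Build _ _ _ _ _ lin).
have cl : continuous l by move=> t; exact: scalel_continuous.
have oT := @openT R^o.
have sf : smooth_on setT f by apply: smoothN => //; exact: (smooth_linear setT cl).
have oW := open_Jregular.
exists (fun t => 2%:R *: Jinv (f t)); split.
- apply: (@smooth_map_on _ _ _ _ (f @^-1` Jregular)).
  + exact: open_smooth_preimage.
  + by move=> t _; exact: (cay t).1.
  + apply: smoothZ; first exact: open_smooth_preimage.
    by apply: smooth_comp_preimage => //; exact: smooth_Jinv.
- move=> t; apply/in_chart_stab; split; first exact/in_chart_UJ/(cay t).2.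
  apply: comm_eltZ => //; apply: comm_inv => //; first exact: (cay t).1.
  by rewrite /f -scaleN1r; apply: comm_eltZ => //; exact: (Lt t).2.
- by rewrite /f scale0r oppr0 Jinv0 scaler0.
- have f0 : f 0 = 0 by rewrite /f scale0r oppr0.
  have df : is_diff (0 : R^o) f (- (fun t : R^o => t *: v2)).
    exact: (is_diffN (is_diff_scalel (0 : R^o) v2)).
  have dJ : is_diff (f 0) Jinv (fun w => - w).
    rewrite f0; have [d0 d0E] := diff_Jinv0.
    by apply: DiffDef => //; apply/funext => w; rewrite d0E.
  have [dk dkE] := is_diffZ 2%:R (is_diff_comp df dJ).
  rewrite derive1E'; last exact: dk.
  rewrite [LHS](congr1 (@^~ 1) dkE) !fctE /= opprK scale1r /v2.
  by rewrite scalerA mulfV ?pnatr_eq0// scale1r.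
Qed.

Lemma stab_one_plus u : UJ_stab dot J a u ->
  exists2 x : elt J, u = one_plus x & unitary dot (one_plus x) /\ comm a x.
Proof.
move=> Nu; have [[Ju _] _] := Nu.
have uE : u = one_plus (Elt Ju) by rewrite /= addrC subrK.
exists (Elt Ju) => //.
have /in_chart_stab[/in_chart_UJ ux xa] : N (Elt Ju) by rewrite /N /in_chart /= addrC subrK.
by [].
Qed.

Lemma stab_op_group : op_group (UJ_stab dot J a).
Proof.
split.
- have h : N 0.
    apply/in_chart_stab; split; last exact: comm0.
    apply/in_chart_UJ; apply: isometry_unitary; last by rewrite one_plus0.
    exact: (skew_regular (skew_adjoint0 dot : skew_adjoint dot (elt_val (0 : elt J)))).
  by move: h; rewrite /N /in_chart /= one_plus0.
- move=> u v /stab_one_plus[x -> [ux xa]] /stab_one_plus[y -> [uy ya]].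
  rewrite -(one_plus_circ).
  by apply/in_chart_stab; split; [apply/in_chart_UJ; exact: unitary_circ|exact: comm_circ].
- move=> u /stab_one_plus[x -> [ux xa]]; have [Wx _] := unitary_regular ux.
  exists (one_plus (Jinv x)).
    by apply/in_chart_stab; split; [apply/in_chart_UJ; exact: unitary_inv|exact: comm_inv].
  by split; apply/funext => h; [exact: Jinv_r|exact: Jinv_l].
Qed.

Lemma stab_lie_group : banach_lie_group J (UJ_stab dot J a) (LUJ_stab dot J a).
Proof.
split.
- by split; [exact: stab_op_group|move=> u [[]]].
- by apply: submanifold_manifold stab_submanifold closed_LUJ _ => x [].
- exists (fun xy : elt J * elt J => Jcirc xy.1 xy.2).
    apply: (@smooth_map_on _ _ _ _ setT) => //; first exact: openT.
    by apply: smooth_Jcirc; [exact: openT|exact: smooth_fst|exact: smooth_snd].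
  by move=> x y _ _; rewrite one_plus_circ.
- have NW x : N x -> Jregular x.
    by move=> /in_chart_stab[/in_chart_UJ ux _]; exact: (unitary_regular ux).1.
  exists Jinv.
    by apply: (smooth_map_on open_Jregular NW); exact: smooth_Jinv.
  by move=> x /NW Wx; apply/funext => h; exact: Jinv_r.
- by apply/seteqP; split; [exact: stab_tangent_sub|exact: stab_tangent_sup].
Qed.

(** The complement is the kernel of the projection onto the commutant. *)
Lemma stab_split (J1 : normedSubspace (H -> H)) :
  dual_pair dot J J1 -> normal_op dot a -> split_subspace g L.
Proof.
move=> JJ1 a_normal.
have [E [EJ Elin Eskew Ecomm Eid]] := commutant_projection H_hilbert JJ1 a_normal.
have [cg g0 glin] := closed_uJ.
have E0 : E 0 = 0.
  by have := Elin (-1) 0 0 (ns_0 J) (ns_0 J); rewrite !scaleN1r oppr0 addr0 addNr.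
have ED b c : J b -> J c -> E (b + c) = E b + E c.
  by move=> Jb Jc; rewrite -{1}[b]scale1r Elin// scale1r.
have EZ (r : R[i]) b : J b -> E (r *: b) = r *: E b.
  by move=> Jb; have := Elin r b 0 Jb (ns_0 J); rewrite E0 !addr0.
split; [exact: closed_LUJ|by move=> x []|].
exists [set x | g x /\ E (elt_val x) = 0]; split.
- split.
  + move=> x clx; split; first by apply: cg; apply: closure_subset clx => y [].
    apply: (ns_norm_eq0 (EJ _ (eltP x)).1); apply/eqP; rewrite eq_le (J_ge0 (EJ _ (eltP x)).1) andbT.
    apply: (closure_norm clx (C := 4)) => y [_ Ey].
    have -> : elt_val x = elt_val (x - y) + elt_val y by rewrite /= subrK.
    rewrite (ED _ _ (eltP (x - y)) (eltP y)) Ey addr0.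
    exact: (EJ _ (eltP (x - y))).2.
  + by split.
  + move=> r x y [gx Ex] [gy Ey]; split; first exact: glin.
    by rewrite /= Elin ?Ex ?Ey ?scaler0 ?addr0//; exact: eltP.
- by move=> x [].
- move=> x [[gx xa] [_ Ex]]; apply: elt_inj => /=; rewrite -Ex; apply/esym/Eid => //.
  + exact: eltP.
  + exact/in_ideal_uJ.
- move=> x gx; have Jx := eltP x; have sx := (in_ideal_uJ x).1 gx.
  have [JE _] := EJ _ Jx.
  have gy : g (Elt JE) by apply/in_ideal_uJ; exact: Eskew.
  exists (Elt JE), (x - Elt JE); split.
  + by split=> //; exact: Ecomm.
  + split; first by rewrite addrC -scaleN1r; exact: glin.
    have -> : elt_val (x - Elt JE) = elt_val x + -1 *: E (elt_val x) by rewrite scaleN1r.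
    rewrite ED// ?EZ//; last by have := (sni_scale sJ (-1) JE).1.
    rewrite (Eid (E _)) ?scaleN1r ?subrr//; [exact: Eskew|exact: Ecomm].
  + by rewrite addrC subrK.
Qed.

End Stabilizer.
End IdealAlgebra.

(** * The projection of the Lie algebra and the theorem *)

Lemma uJ_projection (R : realType) (H : completeNormedModType R[i])
    (dot : {dot H for Num.conj}) (J J1 : normedSubspace (H -> H)) (a : H -> H) :
  is_hilbert dot -> dual_pair dot J J1 -> normal_op dot a ->
  exists E : {linear elt (uJ dot J) -> elt (uJ dot J)},
     [/\ continuous E,
         E \o E = E,
         range (fun x => elt_val (E x)) = LUJ_stab dot J a &
         (forall x, exists y z, [/\ LUJ_stab dot J a (elt_val y), E z = 0 & x = y + z]) /\
         (forall y, LUJ_stab dot J a (elt_val y) -> E y = 0 -> y = 0)].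
Proof.
move=> H_hilbert JJ1 a_normal.
have [E [EJ Elin Eskew Ecomm Eid]] := commutant_projection H_hilbert JJ1 a_normal.
pose F (x : elt (uJ dot J)) : elt (uJ dot J) :=
  Elt (conj (EJ _ (eltP x).1).1 (Eskew _ (eltP x).1 (eltP x).2) : uJ dot J (E (elt_val x))).
have Flin : linear F.
  by move=> r x y; apply: elt_inj; rewrite /= Elin//; [exact: (eltP x).1|exact: (eltP y).1].
pose L' : {linear elt (uJ dot J) -> elt (uJ dot J)} := HB.pack F (GRing.isLinear.Build _ _ _ _ _ Flin).
have FL x : LUJ_stab dot J a (elt_val (F x)) by split; [exact: eltP|exact: Ecomm (eltP x).1].
have Fid x : LUJ_stab dot J a (elt_val x) -> F x = x.
  by move=> [[Jx sx] xa]; apply: elt_inj; exact: Eid.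
exists L'; split.
- by apply: (@bounded_continuous _ _ _ L' 4) => x; exact: (EJ _ (eltP x).1).2.
- by apply/funext => x; exact: Fid.
- apply/seteqP; split=> [_ [x _ <-]|x Lx]; first exact: FL.
  exists (Elt Lx.1) => //; exact: (congr1 (@elt_val _ _ _) (Fid (Elt Lx.1) Lx)).
- split=> [x|y Ly]; last by move=> Ey; rewrite -(Fid y Ly).
  exists (F x), (x - F x); split=> //; last by rewrite addrC subrK.
  by rewrite linearB; apply/eqP; rewrite subr_eq0 eq_sym; apply/eqP; exact: Fid.
Qed.

Theorem proposition3p21 (R : realType) (H : completeNormedModType R[i])
    (dot : {dot H for Num.conj})
    (H_hilbert : is_hilbert dot) (H_separable : separable H)
    (H_infinite_dim : infinite_dim H)
    (J J1 : normedSubspace (H -> H)) (JJ1 : dual_pair dot J J1)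
    (a : H -> H) (a_normal : normal_op dot a) :
  (exists E : {linear elt (uJ dot J) -> elt (uJ dot J)},
     [/\ continuous E,
         E \o E = E,
         range (fun x => elt_val (E x)) = LUJ_stab dot J a &
         (forall x, exists y z, [/\ LUJ_stab dot J a (elt_val y), E z = 0 & x = y + z]) /\
         (forall y, LUJ_stab dot J a (elt_val y) -> E y = 0 -> y = 0)]) /\
  banach_lie_subgroup J (UJ dot J) (uJ dot J)
    (UJ_stab dot J a) (LUJ_stab dot J a).
Proof.
split; first exact: (uJ_projection H_hilbert JJ1 a_normal).
split.
- exact: (stab_lie_group H_hilbert (dp_ideal JJ1) a_normal.1).
- exact: (stab_split H_hilbert (dp_ideal JJ1) a_normal.1 JJ1 a_normal).
- exact: (stab_submanifold H_hilbert (dp_ideal JJ1) a_normal.1).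
Qed.
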